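(* Let $E\subset\partial\mathbb{D}$ be closed with $\partial E=E\setminus E^{\mathrm{int}}$ having capacity zero, where $E^{\mathrm{int}}$ is the interior of $E$ in $\partial\mathbb{D}$. Let $\mu$ be a measure on $\partial\mathbb{D}$ with $\sigma_{\mathrm{ess}}(d\mu)=E$ and $$d\mu=f(x)\,d\rho_E+d\mu_{\mathrm{s}},$$ where $\mu_{\mathrm{s}}$ is $d\rho_E$-singular. Suppose $f(x)>0$ for $d\rho_E$-a.e. $x$. Then $\mu$ is regular, i.e. $\lim_{n\to\infty}(\rho_1\cdots\rho_n)^{1/n}=C(E)$.
   Context: $\partial\mathbb{D}=\{z\in\mathbb{C}:|z|=1\}$. Measures are positive, finite, not necessarily normalized. $\Phi_n$ is the monic orthogonal polynomial of degree $n$ for $\mu$; with $\Phi_n^*(z)=z^n\,\overline{\Phi_n(1/\bar z)}$ the Verblunsky coefficients are defined by $\Phi_{n+1}(z)=z\Phi_n(z)-\bar\alpha_n\Phi_n^*(z)$, and $\rho_n=(1-|\alpha_n|^2)^{1/2}$. $\sigma_{\mathrm{ess}}(d\mu)$ is the essential spectrum of multiplication by $z$ on $L^2(d\mu)$, i.e. the set of non-isolated points of $\mathrm{supp}(d\mu)$. $C(E)$ is the logarithmic capacity of $E$, and $d\rho_E$ is its potential-theoretic equilibrium measure (it is implicit that $C(E)>0$, so that $\rho_E$ is defined). *)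

(* Defs.v *)
From HB Require Import structures.
From mathcomp Require Import all_boot all_order all_algebra.
From mathcomp Require Import complex.
From mathcomp Require Import all_classical all_reals all_analysis.

Set Implicit Arguments.
Unset Strict Implicit.
Unset Printing Implicit Defensive.

Import Order.TTheory GRing.Theory Num.Theory.
Import numFieldNormedType.Exports.

Local Open Scope classical_set_scope.
Local Open Scope ring_scope.

(* R[i] declared as a numClosedFieldType, so that the norm topology that the
   library puts on every numFieldType applies to it. *)
Definition C (R : realType) : numClosedFieldType := R[i].

Notation borelC R := (g_sigma_algebraType (@open (C R))).

Definition cabs (R : realType) (z : C R) : R := Normc.normc z.

Definition circle (R : realType) : set (C R) := [set z | cabs z = 1].
Arguments circle : clear implicits.

Definition circle_interior (R : realType) (E : set (C R)) : set (C R) :=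
  interior (E : set (subspace (circle R))).

Definition cintegral (R : realType)
    (mu : {measure set (borelC R) -> \bar R}) (g : C R -> C R) : C R :=
  Complex (\int[mu]_z complex.Re (g z))%R (\int[mu]_z complex.Im (g z))%R.

Definition supp (R : realType)
    (mu : {measure set (borelC R) -> \bar R}) : set (C R) :=
  [set z | forall U : set (C R), open_nbhs z U -> (0 < mu U)%E].

Definition ess_spectrum (R : realType)
    (mu : {measure set (borelC R) -> \bar R}) : set (C R) :=
  supp mu `\` isolated (supp mu).

(* Meant for nu of bounded support: the kernel is then bounded below nu-a.e.
   It is +oo on the diagonal, since lne 0 = -oo. *)
Definition energy (R : realType) (nu : probability (borelC R) R) : \bar R :=
  (\int[nu]_z \int[nu]_w - lne (cabs (z - w))%:E)%E.

Definition min_energy (R : realType) (E : set (C R)) : \bar R :=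
  ereal_inf
    [set energy nu | nu in [set nu : probability (borelC R) R | nu (~` E) = 0%E]].

(* Meant for bounded Borel sets E; if every probability measure on E has
   infinite energy, or if E is empty, this is expeR -oo = 0. *)
Definition capacity (R : realType) (E : set (C R)) : \bar R :=
  expeR (- min_energy E)%E.

(* Determines nu when E is compact and capacity E > 0. *)
Definition equilibrium_measure (R : realType) (E : set (C R))
    (nu : probability (borelC R) R) : Prop :=
  nu (~` E) = 0%E /\ energy nu = min_energy E.

Definition mutually_singular (R : realType)
    (mu nu : {measure set (borelC R) -> \bar R}) : Prop :=
  exists N : set (borelC R), [/\ measurable N, mu N = 0%E & nu (~` N) = 0%E].

Definition monic_OP (R : realType)
    (mu : {measure set (borelC R) -> \bar R}) (n : nat) (p : {poly C R}) : Prop :=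
  [/\ p \is monic, size p = n.+1 &
      forall j : nat, (j < n)%N ->
        cintegral mu (fun z => (z ^+ j)^* * p.[z]) = 0].

Definition revpoly (R : realType) (n : nat) (p : {poly C R}) : {poly C R} :=
  \poly_(k < n.+1) (p`_(n - k))^*.

Lemma revpolyE (R : realType) (n : nat) (p : {poly C R}) (z : C R) :
  (size p <= n.+1)%N -> z != 0 ->
  (revpoly n p).[z] = z ^+ n * (p.[(z^*)^-1])^*.
Proof.
move=> sp z0; rewrite horner_poly (horner_coef_wide _ sp) rmorph_sum mulr_sumr.
rewrite (reindex_inj rev_ord_inj) /=; apply: eq_bigr => i _.
have lin : (i <= n)%N by rewrite -ltnS.
rewrite subSS subKn// rmorphM rmorphXn fmorphV /= conjCK mulrCA exprVn.
congr (_ * _); have -> : z ^+ n = z ^+ (n - i) * z ^+ i.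
  by rewrite -exprD subnK.
by rewrite mulfK// expf_neq0.
Qed.

Definition verblunsky (R : realType)
    (mu : {measure set (borelC R) -> \bar R}) (alpha : nat -> C R) : Prop :=
  exists Phi : nat -> {poly C R},
    (forall n, monic_OP mu n (Phi n)) /\
    (forall n, Phi n.+1 = 'X * Phi n - (alpha n)^* *: revpoly n (Phi n)).

Definition rho_coef (R : realType) (alpha : nat -> C R) (n : nat) : R :=
  Num.sqrt (1 - cabs (alpha n) ^+ 2).

(* Main.v *)
From HB Require Import structures.
Require Import Defs.
From mathcomp Require Import all_boot all_order all_algebra.
From mathcomp Require Import complex.
From mathcomp Require Import all_classical all_reals all_analysis measurable_realfun.
From mathcomp Require Import ring lra.
Import Order.TTheory GRing.Theory Num.Theory.
Import numFieldNormedType.Exports.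
Local Open Scope classical_set_scope.
Local Open Scope ring_scope.
Set Implicit Arguments.
Unset Strict Implicit.
Unset Printing Implicit Defensive.

(** Let [V] be the minimal energy of [E], so that the capacity is [exp (- V)], let
    [Phi n] be the monic orthogonal polynomials and [X n = L2sq mu (Phi n)] their
    squared norms in [L^2(mu)]. In the recursion the term [alpha_n^* Phi_n^*] has
    degree at most [n], hence is orthogonal to [Phi n.+1]; Pythagoras gives
    [X n.+1 = (1 - |alpha_n|^2) X n], so that the product of the [rho_k] is
    [sqrt (X n.+1 / X 1)] ([prod_rho_coef]). Regularity therefore says that the
    [2n]-th root of [X n] tends to [exp (- V)]. It follows from two exponential
    bounds, valid for all rates [v < V] and [v > V] respectively ([root_limit]).

    Upper bound ([L2sq_upper]). Orthogonal polynomials minimise the norm among monic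
    polynomials, so for [v < V] it suffices to find one monic [p], of some degree
    [m], with [|p| <= exp (- m v)] on the support of [mu]: powers of [p] then serve
    in all degrees. Suppose that there is none ([small_monic]). Choosing points
    greedily in the support, each where the product of the distances to the
    previous ones is large, gives points whose discrete energies stay below [v].
    Their quantile functions have a limit by Helly's theorem, and Fatou's lemma makes
    the limit law a probability measure on the support of energy at most [v]
    ([leja_limit_measure]). A measure of finite energy has no atoms, hence does not
    charge the isolated points of the support, and so lives on [E]: this
    contradicts the minimality of [V].

    Lower bound ([L2sq_lower]). By Frostman's theorem the potential of the
    equilibrium measure is at most [V] on the whole closed disc. Almost everywhere
    this is a first variation ([potential_le_ae]); from there it spreads to the
    circle by comparison with the ends of a gap ([gap_contradiction]) and to the disc
    by averaging over the solutions of [b(u)^n = 1] for a Blaschke factor [b]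
    ([max_disc]). Zeros outside the disc can be reflected, so every monic [p] of
    degree [n] has mean logarithm [ln |p|] at least [- n V] with respect to the
    equilibrium measure ([log_polynomial_integral]). Since [f > 0] almost
    everywhere, [mu] dominates a multiple [de] of the equilibrium measure on a set
    of mass close to [1] ([large_domination]). There the mean of [ln |p|^2] is
    controlled by [L2sq mu p / de], by concavity of the logarithm; on the small rest
    the crude bound [|Phi n| <= 2 ^ n] is enough ([monic_L2_lower_bound]). *)

(** * The modulus, and Borel sets of the plane *)
Section modulus.
Variable R : realType.
Implicit Types z w : C R.

Lemma normcE z : `|z| = (cabs z)%:C%C. Proof. by case: z. Qed.
Lemma cabs_ge0 z : 0 <= cabs z.
Proof. by case: z => x y; exact: sqrtr_ge0. Qed.
Lemma cabsM z w : cabs (z * w) = cabs z * cabs w.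
Proof. exact: Normc.normcM. Qed.
Lemma cabsV z : cabs z^-1 = (cabs z)^-1.
Proof. exact: Normc.normcV. Qed.
Lemma cabs1 : cabs (1 : C R) = 1. Proof. exact: Normc.normc1. Qed.
Lemma cabs0 : cabs (0 : C R) = 0. Proof. exact: Normc.normc0. Qed.
Lemma cabsN z : cabs (- z) = cabs z. Proof. exact: normcN. Qed.
Lemma ler_cabsD z w : cabs (z + w) <= cabs z + cabs w.
Proof. exact: le_normcD. Qed.
Lemma cabsC z w : cabs (z - w) = cabs (w - z).
Proof. by rewrite -cabsN opprB. Qed.
Lemma cabs_eq0 z : (cabs z == 0) = (z == 0).
Proof. by apply/eqP/eqP => [/Normc.eq0_normc//|->]; exact: cabs0. Qed.
Lemma cabs_gt0 z : (0 < cabs z) = (z != 0).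
Proof. by rewrite lt_def cabs_ge0 cabs_eq0 andbT. Qed.
Lemma cabsX z n : cabs (z ^+ n) = cabs z ^+ n.
Proof. by elim: n => [|n IH]; rewrite ?expr0 ?cabs1// !exprS cabsM IH. Qed.
Lemma cabs_conj z : cabs z^* = cabs z.
Proof. by case: z => x y; rewrite /cabs /= sqrrN. Qed.
Lemma cabs_prod (I : Type) (s : seq I) (F : I -> C R) :
  cabs (\prod_(i <- s) F i) = \prod_(i <- s) cabs (F i).
Proof. exact: (big_morph _ cabsM cabs1). Qed.
Lemma ler_cabsB z w x : cabs (z - w) <= cabs (z - x) + cabs (x - w).
Proof. by apply: le_trans (ler_cabsD _ _); rewrite addrA subrK. Qed.
Lemma ler_cabs_dist z w : `|cabs z - cabs w| <= cabs (z - w).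
Proof.
have H (a b : C R) : cabs a - cabs b <= cabs (a - b).
  by rewrite lerBlDr; apply: le_trans (ler_cabsD _ _); rewrite subrK.
by rewrite ler_norml H andbT lerNl opprB cabsC H.
Qed.
Lemma cabs_sqr z : cabs z ^+ 2 = complex.Re z ^+ 2 + complex.Im z ^+ 2.
Proof. by case: z => x y; rewrite /cabs /= sqr_sqrtr// addr_ge0 ?sqr_ge0. Qed.
Lemma conj_mulC z : z^* * z = (cabs z ^+ 2)%:C%C.
Proof. by rewrite cabs_sqr; case: z => x y; simpc; rewrite -!expr2; congr Complex; ring. Qed.
Lemma ler_Re_cabs z : `|complex.Re z| <= cabs z.
Proof.
rewrite -(@ler_pXn2r _ 2)// ?nnegrE ?cabs_ge0//.
by rewrite cabs_sqr real_normK ?num_real// lerDl sqr_ge0.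
Qed.
Lemma ler_Im_cabs z : `|complex.Im z| <= cabs z.
Proof.
rewrite -(@ler_pXn2r _ 2)// ?nnegrE ?cabs_ge0//.
by rewrite cabs_sqr real_normK ?num_real// lerDr sqr_ge0.
Qed.
Lemma circle_neq0 z : circle R z -> z != 0.
Proof. by rewrite /circle/= => h; rewrite -cabs_gt0 h. Qed.
Lemma circle_conj z : circle R z -> z^* = z^-1.
Proof.
move=> h; apply: (mulIf (circle_neq0 h)).
by rewrite conj_mulC h expr1n mulVf// circle_neq0.
Qed.
Lemma circle_dist_le2 z w : circle R z -> circle R w -> cabs (z - w) <= 2.
Proof. by move=> hz hw; apply: (le_trans (ler_cabsD _ _)); rewrite cabsN hz hw. Qed.

Lemma openCP (A : set (C R)) :
  open A <-> forall z, A z -> exists2 r : R, 0 < r & forall w, cabs (z - w) < r -> A w.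
Proof.
rewrite openE; split => [H z Az|H z Az].
  have /nbhs_ballP[r /= r0 rA] := H _ Az.
  have rE : r = (cabs r)%:C%C by rewrite -normcE gtr0_norm.
  exists (cabs r).
    by rewrite cabs_gt0 gt_eqF.
  by move=> w wr; apply: rA; rewrite -ball_normE /= normcE rE ltcR.
have [r r0 rA] := H _ Az.
apply/nbhs_ballP; exists r%:C%C => /=; first by rewrite ltcR.
by move=> w; rewrite -ball_normE /= normcE ltcR; exact: rA.
Qed.

Lemma open_cball z (r : R) : open [set w : C R | cabs (z - w) < r].
Proof.
apply/openCP => w /= zw; exists (r - cabs (z - w)); first by rewrite subr_gt0.
move=> x wx; apply: le_lt_trans (ler_cabsB _ _ w) _.
by rewrite addrC -ltrBrDr.
Qed.

End modulus.

Section measurability.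
Variable R : realType.
Implicit Types z w : C R.

Lemma measurable_open (A : set (borelC R)) : open (A : set (C R)) -> measurable A.
Proof. by move=> oA; exact: sub_sigma_algebra. Qed.

Lemma measurable_closed (A : set (borelC R)) : closed (A : set (C R)) -> measurable A.
Proof.
move=> cA; rewrite -(setCK A); apply: measurableC; apply: measurable_open.
exact: closed_openC.
Qed.

Lemma measurable_lipschitz (g : borelC R -> R) :
  (forall z w, `|g z - g w| <= cabs (z - w)) -> measurable_fun setT g.
Proof.
move=> gl; apply: (measurability _ (RGenOpens.measurableE R)).
move=> _ [_ [a [b ->] <-]]; rewrite setTI; apply: measurable_open.
apply/openCP => z /= /[!in_itv]/= /andP[az zb].
exists (Num.min (g z - a) (b - g z)); first by rewrite lt_min !subr_gt0 az zb.
move=> w; rewrite lt_min => /andP[h1 h2];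
  rewrite in_itv /=; have := gl z w; rewrite ler_norml => /andP[h3 h4].
apply/andP; split; lra.
Qed.

Lemma measurable_Re : measurable_fun setT (@complex.Re R : borelC R -> R).
Proof.
by apply: measurable_lipschitz => z w; rewrite -raddfB; exact: ler_Re_cabs.
Qed.

Lemma measurable_Im : measurable_fun setT (@complex.Im R : borelC R -> R).
Proof.
by apply: measurable_lipschitz => z w; rewrite -raddfB; exact: ler_Im_cabs.
Qed.

Lemma measurable_poly_ReIm (p : {poly C R}) :
  measurable_fun setT ((fun z => complex.Re p.[z]) : borelC R -> R) /\
  measurable_fun setT ((fun z => complex.Im p.[z]) : borelC R -> R).
Proof.
elim/poly_ind: p => [|p c [IHr IHi]].
  by split; under eq_fun do rewrite horner0 /=; exact: measurable_cst.
have E z : p.[z] * z + c = Complex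
   (complex.Re p.[z] * complex.Re z - complex.Im p.[z] * complex.Im z + complex.Re c)
   (complex.Re p.[z] * complex.Im z + complex.Im p.[z] * complex.Re z + complex.Im c).
  by case: (p.[z]) => a b; case: z => x y; case: (c) => u v; simpc.
split; under eq_fun do rewrite hornerMXaddC E /=.
- apply: measurable_funD => //; apply: measurable_funB; apply: measurable_funM => //;
  by [exact: measurable_Re|exact: measurable_Im].
- apply: measurable_funD => //; apply: measurable_funD; apply: measurable_funM => //;
  by [exact: measurable_Re|exact: measurable_Im].
Qed.

Lemma measurable_poly_cabs (p : {poly C R}) :
  measurable_fun setT ((fun z => cabs p.[z]) : borelC R -> R).
Proof.
have [hr hi] := measurable_poly_ReIm p.
have -> : (fun z => cabs p.[z]) =
    Num.sqrt \o (fun z => complex.Re p.[z] ^+ 2 + complex.Im p.[z] ^+ 2).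
  by apply/funext => x /=; case: (p.[x]).
apply: measurableT_comp; first exact: continuous_measurable_fun (@sqrt_continuous R).
by apply: measurable_funD; exact: measurable_funX.
Qed.

Lemma measurable_dist :
  measurable_fun setT ((fun p => cabs ((p.1 : C R) - p.2)) : borelC R * borelC R -> R).
Proof.
have -> : (fun p : borelC R * borelC R => cabs ((p.1 : C R) - p.2)) =
    Num.sqrt \o (fun p => (complex.Re p.1 - complex.Re p.2) ^+ 2
                        + (complex.Im p.1 - complex.Im p.2) ^+ 2).
  by apply/funext => -[[a b] [c d]].
apply: measurableT_comp; first exact: continuous_measurable_fun (@sqrt_continuous R).
have h1 : measurable_fun setT (fun p : borelC R * borelC R => complex.Re p.1).
  exact: measurableT_comp measurable_Re measurable_fst.
have h2 : measurable_fun setT (fun p : borelC R * borelC R => complex.Im p.1).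
  exact: measurableT_comp measurable_Im measurable_fst.
have h3 : measurable_fun setT (fun p : borelC R * borelC R => complex.Re p.2).
  exact: measurableT_comp measurable_Re measurable_snd.
have h4 : measurable_fun setT (fun p : borelC R * borelC R => complex.Im p.2).
  exact: measurableT_comp measurable_Im measurable_snd.
by apply: measurable_funD; apply: measurable_funX; exact: measurable_funB.
Qed.

Lemma closed_circle : closed (circle R).
Proof.
rewrite -(setCK (circle R)); apply: open_closedC; apply/openCP => z /= z1.
exists `|cabs z - 1|; first by rewrite normr_gt0 subr_eq0; apply/eqP.
move=> w zw w1; have := ler_cabs_dist z w; rewrite w1.
by rewrite leNgt zw.
Qed.

(** The plane is second countable: the discs with rational centre and radius
    form a base, and countably many of them that are null cover [A]. *)
Lemma null_of_locally_null (m : {measure set (borelC R) -> \bar R})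
    (A : set (borelC R)) : measurable A ->
  (forall z, A z -> exists2 U : set (C R), open_nbhs z U & m U = 0%E) -> m A = 0%E.
Proof.
move=> mA H.
pose D (q : rat * rat * rat) : set (borelC R) :=
  [set w : C R | cabs (Complex (ratr q.1.1) (ratr q.1.2) - w) < ratr q.2].
have mD q : measurable (D q) by apply: measurable_open; exact: open_cball.
have [g gP] : exists g : nat -> option (rat * rat * rat), forall q, exists k, g k = Some q.
  by exists unpickle => q; exists (pickle q); rewrite pickleK.
pose F (k : nat) : set (borelC R) :=
  if g k is Some q then (if m (D q) == 0%E then D q else set0) else set0.
apply: measure_negligible => //.
apply: (@negligibleS _ _ _ m (\bigcup_k F k)); last first.
  apply: negligible_bigcup => k; rewrite /F.
  case: (g k) => [q|]; last exact: negligible_set0.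
  case: ifPn => [/eqP mq|_]; last exact: negligible_set0.
  by apply/negligibleP.
move=> z /H [U [oU Uz] mU].
  have /openCP/(_ _ Uz)[r r0 rU] := oU.
  have r40 : 0 < r / 4 by rewrite divr_gt0.
  have [a] := @rat_in_itvoo _ (complex.Re z - r/4) (complex.Re z) ltac:(lra).
  rewrite in_itv /= => /andP[a1 a2].
  have [b] := @rat_in_itvoo _ (complex.Im z - r/4) (complex.Im z) ltac:(lra).
  rewrite in_itv /= => /andP[b1 b2].
  have [c] := @rat_in_itvoo _ (3 * r / 8) (5 * r / 8) ltac:(lra).
  rewrite in_itv /= => /andP[c1 c2].
  pose o : C R := Complex (ratr a) (ratr b).
  have oz : cabs (o - z) < 3 * r / 8.
    rewrite -(@ltr_pXn2r _ 2)// ?nnegrE ?cabs_ge0//; last by lra.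
    rewrite cabs_sqr /o; case: (z) a1 a2 b1 b2 => x y /=; nra.
  have Dz : D (a, b, c) z by rewrite /D /=; apply: lt_trans c1.
  have DU : D (a, b, c) `<=` U.
    move=> w; rewrite /D /= => ow; apply: rU.
    apply: le_lt_trans (ler_cabsB _ _ o) _; rewrite (cabsC z).
    move: ow; rewrite -/o => ow; lra.
  have [k gk] := gP (a, b, c).
  exists k => //; rewrite /F gk ifT//.
  by rewrite -measure_le0 -mU le_measure// inE//; apply: measurable_open.
Qed.
End measurability.

(** * Integration *)
Section integration.
Context d (T : measurableType d) (R : realType).

Lemma ge0_integral_mrestr (m : {measure set T -> \bar R}) (A : set T)
    (mA : measurable A) (f : T -> \bar R) :
  measurable_fun setT f -> (forall x, 0 <= f x)%E ->
  (\int[mrestr m mA]_x f x = \int[m]_(x in A) f x)%E.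
Proof.
move=> mf f0.
have mCA : measurable (~` A) by exact: measurableC.
rewrite (@ge0_negligible_integral _ _ _ _ setT (~` A))//; last first.
  by rewrite /= /mrestr setICl measure0.
rewrite setTD setCK; apply: eq_measure_integral => B mB BA.
by rewrite /= /mrestr setIidl.
Qed.

(** The integral of [f] may be infinite, so that linearity for integrable functions
    does not apply; only the negative part of [f - c] has a finite integral. *)
Lemma integralB_cst (P : probability T R) (f : T -> \bar R) (c : R) :
  0 <= c -> measurable_fun setT f -> (forall x, 0 <= f x)%E ->
  (\int[P]_x (f x - c%:E) = \int[P]_x f x - c%:E)%E.
Proof.
move=> c0 mf f0; pose g x := (f x - c%:E)%E.
have mg : measurable_fun setT g by apply: emeasurable_funB.
have Pc : (\int[P]_x (cst c%:E x) = c%:E)%E.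
  rewrite integral_cst// [X in (_ * X)%E](_ : _ = 1%E) ?mule1//.
  exact: probability_setT.
have H : (\int[P]_x g^\+ x + c%:E = \int[P]_x f x + \int[P]_x g^\- x)%E.
  rewrite -[in LHS]Pc -!ge0_integralD//; last 2 first.
  - exact: measurable_funeneg.
  - exact: measurable_funepos.
  apply: eq_integral => x _; rewrite funeposE funenegE /g /=.
  case: (f x) (f0 x) => [r||]//=; rewrite ?lee_fin => r0.
  - rewrite -!EFinD -!EFin_max -!EFinD; congr EFin.
    by rewrite /Num.max; case: ltP => ?; case: ltP => ?; lra.
  - by rewrite maxNye addye// (_ : (+oo + (- c)%:E = +oo)%E)// maxye.
have Hc : (\int[P]_x g^\- x <= c%:E)%E.
  rewrite -[leRHS]Pc; apply: ge0_le_integral => //; first exact: measurable_funeneg.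
  move=> x _; rewrite funenegE /g; case: (f x) (f0 x) => [r||]//= r0; last first.
    by rewrite maxNye lee_fin.
  rewrite lee_fin in r0.
  rewrite -EFin_max lee_fin ge_max c0 andbT; lra.
have Hf : (\int[P]_x g^\- x)%E \is a fin_num.
  by rewrite ge0_fin_numE ?integral_ge0// (le_lt_trans Hc)// ltry.
rewrite [LHS]integralE -/g.
move: H Hf; case: (\int[P]_x g^\- x)%E => [b||]// H _.
have : (0 <= \int[P]_x f x)%E by exact: integral_ge0.
have : (0 <= \int[P]_x g^\+ x)%E by exact: integral_ge0.
move: H; case: (\int[P]_x f x)%E => [a||]//; case: (\int[P]_x g^\+ x)%E => [e||]//=.
by move=> [H] _ _; rewrite -!EFinB; congr EFin; lra.
Qed.

End integration.

Section almost_everywhere.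
Context d (T : measurableType d) (R : realType) (m : {measure set T -> \bar R}).
Implicit Types P Q S : T -> Prop.

Lemma aeS P Q : (forall x, P x -> Q x) -> {ae m, forall x, P x} -> {ae m, forall x, Q x}.
Proof. by move=> PQ; apply: filterS. Qed.

Lemma aeS2 P Q S : (forall x, P x -> Q x -> S x) ->
  {ae m, forall x, P x} -> {ae m, forall x, Q x} -> {ae m, forall x, S x}.
Proof. by move=> PQS; apply: filterS2. Qed.

End almost_everywhere.

Section fatou_inferior.
Context d (T : measurableType d) (R : realType) (m : {measure set T -> \bar R}).

Lemma limn_einf_le (u : (\bar R)^nat) (c : \bar R) :
  (forall n, u n <= c)%E -> (limn_einf u <= c)%E.
Proof.
move=> uc; rewrite limn_einf_lim; apply: lime_le; first exact: is_cvg_einfs.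
by apply: nearW => n; apply: le_trans (uc n); apply: ereal_inf_lbound; exists n => /=.
Qed.

Lemma fatou_einf (f : (T -> \bar R)^nat) (g : T -> \bar R) :
  (forall n, measurable_fun setT (f n)) -> measurable_fun setT g ->
  (forall n x, 0 <= f n x)%E -> (forall x, 0 <= g x)%E ->
  {ae m, forall x, (g x <= limn_einf (f ^~ x))%E} ->
  (\int[m]_x g x <= limn_einf (fun n => \int[m]_x f n x))%E.
Proof.
move=> mf mg f0 g0 gf; apply: le_trans (fatou m measurableT mf _) => //.
apply: ae_ge0_le_integral => //.
- move=> x _; rewrite limn_einf_lim; apply: lime_ge; first exact: is_cvg_einfs.
  by apply: nearW => n; apply: le_ereal_inf_tmp => _ [k _ <-].
- rewrite /limn_einf; apply: measurableT_comp => //; apply: measurable_fun_limn_esup => n.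
  exact: measurableT_comp.
- by apply: aeS gf => x h _.
Qed.

End fatou_inferior.

(** * The logarithmic kernel and potentials *)
Section kernel.
Variable R : realType.
Implicit Types (d : R) (z w : C R).

(** The logarithmic kernel shifted by [ln 2], the logarithm of the diameter of
    the circle, and cut off at [0]: on the circle the cut-off is inactive, and
    nonnegativity makes Tonelli's theorem and Fatou's lemma available. *)
Definition kap d : \bar R :=
  if d <= 0 then +oo%E else (Num.max 0 (ln 2 - ln d))%:E.

Lemma kap_ge0 d : (0 <= kap d)%E.
Proof. by rewrite /kap; case: ifP => // _; rewrite lee_fin le_max lexx. Qed.

Lemma kapE d : 0 < d -> d <= 2 -> kap d = (ln 2 - ln d)%:E.
Proof.
move=> d0 d2; rewrite /kap (leNgt d) d0 /=; congr EFin; apply/max_idPr.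
by rewrite subr_ge0 ler_ln// posrE.
Qed.

Lemma measurable_kap : measurable_fun setT kap.
Proof.
apply: measurable_fun_ifT.
- exact: measurable_fun_ler.
- exact: measurable_cst.
- apply/measurable_EFinP; apply: measurable_maxr => //.
  by apply: measurable_funB => //; exact: measurable_ln.
Qed.

Lemma kap_cvg (u : R^nat) d : u @ \oo --> d -> kap \o u @ \oo --> kap d.
Proof.
move=> ud; rewrite /kap; have [d0|d0] := leP d 0.
- apply/cvgeyPge => A.
  have e0 : 0 < expR (ln 2 - A) by exact: expR_gt0.
  have : \forall k \near \oo, u k < expR (ln 2 - A).
    by apply: (cvgr_lt _ ud); apply: le_lt_trans e0.
  apply: filterS => k uk /=; have [_|uk0] := leP (u k) 0; first by rewrite leey.
  rewrite lee_fin le_max; apply/orP; right.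
  have : ln (u k) <= ln (expR (ln 2 - A)) by rewrite ler_ln ?posrE// ltW.
  by rewrite expRK => h; lra.
- apply: (@cvg_trans _ ((fun k => (Num.max 0 (ln 2 - ln (u k)))%:E) @ \oo)).
    apply: near_eq_cvg; have : \forall k \near \oo, 0 < u k by exact: (cvgr_gt _ ud).
    by apply: filterS => k uk /=; rewrite (leNgt (u k)) uk.
  apply: cvg_EFin; first exact: nearW.
  have E x : Num.max 0 x = (x + `|x|) / 2 :> R.
    by rewrite /Num.max; case: ltP => h; [rewrite gtr0_norm|rewrite ler0_norm]; lra.
  rewrite E; under eq_fun do rewrite /= E.
  have H : (fun k => ln 2 - ln (u k)) @ \oo --> ln 2 - ln d.
    by apply: cvgB; [exact: cvg_cst|exact: (continuous_cvg _ (continuous_ln d0))].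
  by apply: cvgMl; apply: cvgD => //; exact: cvg_norm.
Qed.

Lemma measurable_kap_dist :
  measurable_fun setT
    ((fun p => kap (cabs ((p.1 : C R) - p.2))) : borelC R * borelC R -> \bar R).
Proof. by apply: measurableT_comp; [exact: measurable_kap|exact: measurable_dist]. Qed.

Lemma measurable_dist_l z :
  measurable_fun setT ((fun w => cabs (z - w)) : borelC R -> R).
Proof.
by apply: measurable_lipschitz => x y; apply: le_trans (ler_cabs_dist _ _) _;
  rewrite opprB addrC addrA subrK cabsC.
Qed.

Lemma measurable_kap_l z :
  measurable_fun setT ((fun w => kap (cabs (z - w))) : borelC R -> \bar R).
Proof.
by apply: measurableT_comp; [exact: measurable_kap|exact: measurable_dist_l].
Qed.

Definition pot (nu : {measure set (borelC R) -> \bar R}) z : \bar R :=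
  (\int[nu]_w kap (cabs (z - w)))%E.

Lemma pot_ge0 nu z : (0 <= pot nu z)%E.
Proof. by apply: integral_ge0 => w _; exact: kap_ge0. Qed.

End kernel.

Section potentials.
Variable R : realType.
Implicit Types (d : R) (z w : C R).

Lemma measurable_pot (nu : {sigma_finite_measure set (borelC R) -> \bar R}) :
  measurable_fun setT (pot nu : borelC R -> \bar R).
Proof.
have := @measurable_fun_fubini_tonelli_F _ _ _ _ _ nu _ (@measurable_kap_dist R).
by apply => x; exact: kap_ge0.
Qed.

Lemma ae_circle (nu : {measure set (borelC R) -> \bar R}) :
  nu (~` circle R) = 0%E -> {ae nu, forall z, circle R z}.
Proof.
move=> h; exists (~` circle R); split => //.
by apply: measurableC; apply: measurable_closed; exact: closed_circle.
Qed.

Lemma nlneE d : (- lne d%:E)%E = if d <= 0 then +oo%E else (- ln d)%:E.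
Proof.
by case: leP => d0; [rewrite le0_lneNy// lee_fin|rewrite lne_EFin].
Qed.

Lemma nlne_kap d : d <= 2 -> (- lne d%:E = kap d - (ln 2)%:E)%E.
Proof.
rewrite nlneE /kap => d2; case: leP => // d0; rewrite -EFinB; congr EFin.
rewrite (max_idPr _) ?subr_ge0 ?ler_ln ?posrE//; lra.
Qed.

(** On the circle no distance exceeds [2], so there the kernel of the energy is the
    cut-off kernel minus the constant [ln 2]. *)
Lemma energyE (nu : probability (borelC R) R) : nu (~` circle R) = 0%E ->
  energy nu = (\int[nu]_z pot nu z - (ln 2)%:E)%E.
Proof.
move=> nuC; have ln20 : 0 <= ln 2 :> R by rewrite ln_ge0// ler1n.
have aec := ae_circle nuC.
have mk (z : C R) : measurable_fun setT ((fun w => - lne (cabs (z - w))%:E)%E : borelC R -> \bar R).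
  under eq_fun do rewrite nlneE.
  apply: measurable_fun_ifT => //.
    by apply: measurable_fun_ler => //; exact: measurable_dist_l.
  apply/measurable_EFinP; apply: measurableT_comp => //.
  by apply: measurableT_comp; [exact: measurable_ln|exact: measurable_dist_l].
have mk2 : measurable_fun setT
    ((fun p => - lne (cabs (p.1 - p.2 : C R))%:E)%E : borelC R * borelC R -> \bar R).
  under eq_fun do rewrite nlneE.
  apply: measurable_fun_ifT => //.
    by apply: measurable_fun_ler => //; exact: measurable_dist.
  apply/measurable_EFinP; apply: measurableT_comp => //.
  by apply: measurableT_comp; [exact: measurable_ln|exact: measurable_dist].
rewrite /energy -integralB_cst//; last 2 first.
- exact: measurable_pot.
- by move=> z; exact: pot_ge0.
apply: ae_eq_integral => //.
- under eq_fun do rewrite integralE.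
  apply: emeasurable_funB.
    have := @measurable_fun_fubini_tonelli_F _ _ _ _ _ nu _ (measurable_funepos mk2).
    move=> H; have {}H := H (fun=> funepos_ge0 _ _); apply: eq_measurable_fun H => z _.
    by apply: eq_integral => w _; rewrite !funeposE.
  have := @measurable_fun_fubini_tonelli_F _ _ _ _ _ nu _ (measurable_funeneg mk2).
  move=> H; have {}H := H (fun=> funeneg_ge0 _ _); apply: eq_measurable_fun H => z _.
  by apply: eq_integral => w _; rewrite !funenegE.
- by apply: emeasurable_funB => //; exact: measurable_pot.
apply: (aeS _ aec) => z cz _; cbv beta.
rewrite -integralB_cst//; last 2 first.
- exact: measurable_kap_l.
- by move=> w; exact: kap_ge0.
apply: ae_eq_integral; [by []|exact: mk| |].
  by apply: emeasurable_funB => //; exact: measurable_kap_l.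
by apply: (aeS _ aec) => w cw _; cbv beta; rewrite nlne_kap// circle_dist_le2.
Qed.

(** Lower semicontinuity of the potential: the kernel is continuous as a function
    into the extended reals, with value [+oo] on the diagonal, and Fatou's lemma
    applies to its nonnegative values. *)
Lemma pot_lsc (nu : probability (borelC R) R) (u : nat -> C R) z (c : \bar R) :
  (fun n => cabs (u n - z)) @ \oo --> (0 : R) ->
  (forall n, pot nu (u n) <= c)%E -> (pot nu z <= c)%E.
Proof.
move=> uz uc.
apply: le_trans (limn_einf_le uc).
apply: (@fatou_einf _ _ _ nu (fun n w => kap (cabs (u n - w)))).
- by move=> n; exact: measurable_kap_l.
- exact: measurable_kap_l.
- by move=> n w; exact: kap_ge0.
- by move=> w; exact: kap_ge0.
- apply: aeW => w.
  suff /cvg_limn_einf_sup[-> _] : (fun n => kap (cabs (u n - w))) @ \oo -->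
      kap (cabs (z - w)) by [].
  apply: (@kap_cvg _ (fun n => cabs (u n - w))).
  have H : (fun n => cabs (u n - w) - cabs (z - w)) @ \oo --> (0 : R).
    apply: (@squeeze_cvgr _ _ _ _ (fun n => - cabs (u n - z)) (fun n => cabs (u n - z))) => //.
      apply: nearW => n; have := ler_cabs_dist (u n - w) (z - w).
      by rewrite ler_norml opprB addrA subrK.
    by rewrite -oppr0; exact: cvgN.
  exact/subr_cvg0.
Qed.

End potentials.

(** * Frostman's theorem almost everywhere *)
Section tilted_measure.
Context d (T : measurableType d) (R : realType) (P : probability T R).
Variables (A : set T) (mA : measurable A) (s t : {nonneg R}).
Hypothesis st1 : ((s%:num)%:E + (t%:num)%:E * P A = 1)%E.

(** The competitor of the variational argument: part of the mass of [P] is moved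
    onto [A], which gives [s P] plus [t] times the restriction of [P] to [A]. *)
Definition tilt : set T -> \bar R :=
  measure_add (mscale s P) (mscale t (mrestr P mA)).

HB.instance Definition _ := Measure.on tilt.

Let tilt_setT : tilt setT = 1%E.
Proof.
rewrite /tilt measure_addE /= /mscale /= /mrestr setTI [X in (_ * X + _)%E]probability_setT.
by rewrite mule1.
Qed.

HB.instance Definition _ := Measure_isProbability.Build _ _ _ tilt tilt_setT.

Definition tiltp : probability T R := tilt.

Lemma integral_tilt (f : T -> \bar R) :
  measurable_fun setT f -> (forall x, 0 <= f x)%E ->
  (\int[tiltp]_x f x = (s%:num)%:E * \int[P]_x f x + (t%:num)%:E * \int[P]_(x in A) f x)%E.
Proof.
move=> mf f0; rewrite ge0_integral_measure_add// !ge0_integral_mscale//.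
by rewrite ge0_integral_mrestr.
Qed.

End tilted_measure.
Arguments tiltp {d T R} P {A} mA {s t} st1.

(** The first variation. With [a] the mass of [A], [V] the energy of the measure,
    [b] the mutual energy of the measure and its restriction to [A], and [c] the
    energy of that restriction, the hypothesis on [t] compares [V] with the energy
    of the tilted measure. The latter equals [V] at [t = 0], where its derivative [2 (b - a V)] is at
    most [- 2 a e]. *)
Lemma tilt_contradiction (R : realFieldType) (V a b c e : R) :
  0 < a -> a <= 1 -> 0 < e -> b <= (V - e) * a -> c <= V -> 0 <= V ->
  (forall t, 0 <= t -> t <= 2^-1 ->
    V <= (1 - t * a) * ((1 - t * a) * V + t * b) + t * ((1 - t * a) * b + t * c)) ->
  False.
Proof.
move=> a0 a1 e0 hb hc V0 H.
(* For [t <= q] the quadratic term [t ^ 2 * c] is at most half of the linear gain. *)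
pose q := a * e / (2 * (V + 1)).
have V1 : 0 < 2 * (V + 1) by lra.
have q0 : 0 < q by rewrite divr_gt0// mulr_gt0.
have qE : q * (2 * (V + 1)) = a * e by rewrite /q divfK// gt_eqF.
have [t [t0 t2 tq]] : exists t, [/\ 0 < t, t <= 2^-1 & t <= q].
  have [h|h] := leP q 2^-1; first by exists q.
  by exists 2^-1; rewrite invr_gt0 ltr0n lexx ltW.
have := H t (ltW t0) t2.
have ta : t * a <= 2^-1 by rewrite (le_trans _ t2)// ler_piMr// ltW.
have ta0 : 0 < t * a by rewrite mulr_gt0.
set x := t * a in ta ta0 *.
have h1 : (1 - x) * (t * b) <= (1 - x) * (t * ((V - e) * a)).
  by rewrite ler_wpM2l// ?ler_wpM2l//; [lra|exact: ltW].
have h2 : t * (t * c) <= t * (t * V) by rewrite !ler_wpM2l// ltW.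
have h3 : t * V < a * e.
  have : t * (2 * (V + 1)) <= a * e by rewrite -qE ler_wpM2r// ltW.
  have : 0 <= t * V by rewrite mulr_ge0// ltW.
  lra.
have h4 : t * (t * V) < t * (a * e) by rewrite ltr_pM2l.
have h5 : t * (a * e) <= 2 * (1 - x) * (x * e).
  have -> : t * (a * e) = x * e by rewrite /x; ring.
  have x2 : 1 <= 2 * (1 - x) by lra.
  by rewrite ler_peMl// ltW// mulr_gt0.
have h6 : (1 - x) * ((1 - x) * V + t * b) + t * ((1 - x) * b + t * c) =
  (1 - x) ^+ 2 * V + 2 * ((1 - x) * (t * b)) + t * (t * c) by ring.
rewrite h6 => h7.
have h8 : (1 - x) * (t * ((V - e) * a)) = (1 - x) * (x * (V - e)).
  by rewrite /x; ring.
have h9 : (1 - x) ^+ 2 * V + 2 * ((1 - x) * (x * (V - e))) =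
   V - x ^+ 2 * V - 2 * (1 - x) * (x * e) by ring.
have h10 : 0 <= x ^+ 2 * V by rewrite mulr_ge0// sqr_ge0.
lra.
Qed.

Section frostman.
Variables (R : realType) (rho : probability (borelC R) R) (E : set (borelC R)).
Variable V : R.
Hypothesis mE : measurable E.
Hypothesis rhoE : rho (~` E) = 0%E.
Hypothesis rhoV : (\int[rho]_z pot rho z = V%:E)%E.
Hypothesis minV : forall nu : probability (borelC R) R,
  nu (~` E) = 0%E -> (V%:E <= \int[nu]_z pot nu z)%E.

Let V0 : 0 <= V.
Proof. by rewrite -lee_fin -rhoV integral_ge0// => z _; exact: pot_ge0. Qed.

(** If [A] had positive mass, moving mass onto it would lower the energy. *)
Lemma low_potential_null (A : set (borelC R)) (e : R) : measurable A -> 0 < e ->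
  (forall z, A z -> (pot rho z <= (V - e)%:E)%E) -> rho A = 0%E.
Proof.
move=> mA e0 hA; apply: contrapT => rA0.
have Aoo : (rho A < +oo)%E by rewrite ltey_eq fin_num_measure.
pose rA := mfrestr mA Aoo.
have int_rA (f : borelC R -> \bar R) : measurable_fun setT f ->
    (forall x, 0 <= f x)%E -> (\int[rA]_z f z = \int[rho]_(z in A) f z)%E.
  by move=> mf f0; rewrite -(ge0_integral_mrestr rho mA mf f0); exact: eq_measure_integral.
have mU := @measurable_pot _ rho; have mUA := @measurable_pot _ rA.
have U0 := @pot_ge0 _ rho; have UA0 := @pot_ge0 _ rA.
have symm : (\int[rho]_z pot rA z = \int[rho]_(z in A) pot rho z)%E.
  rewrite -int_rA// /pot.
  rewrite (fubini_tonelli (m1 := rho) (m2 := rA)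
    (fun p : borelC R * borelC R => kap (cabs (p.1 - p.2 : C R)))) /=; last 2 first.
  - exact: measurable_kap_dist.
  - by move=> p; exact: kap_ge0.
  by apply: eq_integral => z _; apply: eq_integral => w _; rewrite cabsC.
have UAU z : (pot rA z <= pot rho z)%E.
  have mk := measurable_kap_l z.
  have k0 (w : borelC R) : (0 <= kap (cabs (z - w : C R)))%E by exact: kap_ge0.
  by rewrite {1}/pot int_rA//; exact: ge0_subset_integral.
have fin_le (x : \bar R) (y : R) : (0 <= x)%E -> (x <= y%:E)%E -> exists2 r, x = r%:E & r <= y.
  by case: x => [r||]//= _ h; exists r; rewrite -?lee_fin.
have [a aE a1] : exists2 a, rho A = a%:E & a <= 1.
  by apply: fin_le; [exact: measure_ge0|exact: probability_le1].
have a0 : 0 < a.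
  have : (0 <= rho A)%E by exact: measure_ge0.
  by rewrite aE lee_fin le_eqVlt => /orP[/eqP a0|//]; case: rA0; rewrite aE -a0.
have [b bE hb] : exists2 b, (\int[rho]_(z in A) pot rho z)%E = b%:E & b <= (V - e) * a.
  apply: fin_le; first by apply: integral_ge0 => *; exact: U0.
  have : (\int[rho]_(z in A) pot rho z <= \int[rho]_(z in A) (cst (V - e)%:E z))%E.
    apply: ge0_le_integral => //; first exact: measurable_funTS.
  by rewrite integral_cst// => h; apply: (le_trans h); rewrite EFinM -aE.
have [c cE hc] : exists2 c, (\int[rho]_(z in A) pot rA z)%E = c%:E & c <= V.
  apply: fin_le; first by apply: integral_ge0 => *; exact: UA0.
  rewrite -rhoV; apply: (@le_trans _ _ (\int[rho]_z pot rA z)%E).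
    by apply: ge0_subset_integral => //; move=> z _; exact: UA0.
  by apply: ge0_le_integral.
apply: (tilt_contradiction a0 a1 e0 hb hc V0) => t t0 t2.
have s0 : 0 <= 1 - t * a.
  have : t * a <= t by rewrite ler_piMr.
  lra.
pose s' := NngNum s0; pose t' := NngNum t0.
have st1 : ((s'%:num)%:E + (t'%:num)%:E * rho A = 1)%E.
  by rewrite aE /= -EFinM -EFinD subrK.
pose nu := tiltp rho mA st1.
have nuE : nu (~` E) = 0%E.
  rewrite /nu /tiltp /= /tilt measure_addE /= /mscale /= /mrestr rhoE mule0 add0e.
  rewrite (@subset_measure0 _ _ _ rho (~` E `&` A) (~` E)) ?mule0//.
  - by apply: measurableI => //; exact: measurableC.
  - exact: measurableC.
have potnu z : (pot nu z = s'%:num%:E * pot rho z + t'%:num%:E * pot rA z)%E.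
  have mk := measurable_kap_l z.
  have k0 (w : borelC R) : (0 <= kap (cabs (z - w : C R)))%E by exact: kap_ge0.
  by rewrite /pot integral_tilt// int_rA.
have int_comb (D : set (borelC R)) : measurable D ->
  (\int[rho]_(z in D) pot nu z = s'%:num%:E * \int[rho]_(z in D) pot rho z
     + t'%:num%:E * \int[rho]_(z in D) pot rA z)%E.
  move=> mD; under eq_integral do rewrite potnu.
  have mDU : measurable_fun D (pot rho) by exact: measurable_funTS.
  have mDA : measurable_fun D (pot rA) by exact: measurable_funTS.
  have ge0s (g : borelC R -> \bar R) (q : {nonneg R}) : (forall z, 0 <= g z)%E ->
      forall z, D z -> (0 <= q%:num%:E * g z)%E by move=> g0 z _; rewrite mule_ge0// lee_fin.
  rewrite (ge0_integralD _ mD (ge0s _ s' U0) (measurable_funeM _ mDU)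
     (ge0s _ t' UA0) (measurable_funeM _ mDA)).
  by rewrite !ge0_integralZl.
have := minV nuE.
rewrite integral_tilt; last 2 first.
- exact: measurable_pot.
- exact: pot_ge0.
rewrite !int_comb// rhoV symm bE cE.
by move=> h; rewrite -lee_fin; exact: h.
Qed.

(** The potential is almost everywhere at least [V], by [low_potential_null], and
    its mean is [V]; hence it equals [V] almost everywhere. *)
Lemma potential_le_ae : {ae rho, forall z, (pot rho z <= V%:E)%E}.
Proof.
have mU := @measurable_pot _ rho; have U0 := @pot_ge0 _ rho.
have ae_ge : {ae rho, forall z, (V%:E <= pot rho z)%E}.
  pose A n : set (borelC R) := [set z | (pot rho z <= (V - n.+1%:R^-1)%:E)%E].
  have mA n : measurable (A n).
    rewrite -[A n]setTI; exact: emeasurable_fun_infty_c.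
  have A0 n : rho.-negligible (A n).
    by apply/negligibleP => //; exact: (@low_potential_null _ n.+1%:R^-1).
  apply: negligibleS (negligible_bigcup A0) => z /= /negP; rewrite -ltNge => zV.
  have [u uE] : exists u, pot rho z = u%:E.
    by case: (pot rho z) zV (U0 z) => [u _ _|//|//]; exists u.
  rewrite uE lte_fin in zV.
  have [n nu] := @ltr_add_invr _ u V zV.
  by exists n => //; rewrite /A /= uE lee_fin lerBrDr ltW.
have maxV : (\int[rho]_z maxe (pot rho z) V%:E = V%:E)%E.
  rewrite -[RHS]rhoV; apply: ge0_ae_eq_integral => //.
  - by apply: measurable_maxe => //; exact: measurable_cst.
  - by move=> z _; rewrite le_max U0.
  - by apply: (aeS _ ae_ge) => z hz _; apply/max_idPl.
have mg : measurable_fun setT (fun z : borelC R => (maxe (pot rho z) V%:E - V%:E)%E).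
  by apply: emeasurable_funB => //; apply: measurable_maxe.
have : (\int[rho]_z (maxe (pot rho z) V%:E - V%:E) = 0)%E.
  rewrite integralB_cst// ?maxV ?subee//.
  - by apply: measurable_maxe.
  - by move=> z; rewrite le_max U0.
have g0 z : (0 <= maxe (pot rho z) V%:E - V%:E)%E.
  by rewrite sube_ge0// le_max lexx orbT.
have -> : (\int[rho]_z (maxe (pot rho z) V%:E - V%:E) =
   \int[rho]_z `|maxe (pot rho z) V%:E - V%:E|)%E.
  by apply: eq_integral => z _; rewrite gee0_abs.
move/(ae_eq_integral_abs rho measurableT mg).
apply: aeS => z /(_ Logic.I) /= h.
have : (maxe (pot rho z) V%:E <= V%:E)%E by rewrite -sube_le0// h.
by rewrite ge_max => /andP[].
Qed.

End frostman.

(** * Concavity of the logarithm *)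
Section logarithm.
Variable R : realType.
Implicit Types x y a b c : R.

Lemma ln_le_tangent x c : 0 < x -> 0 < c -> ln x <= x / c - 1 + ln c.
Proof.
move=> x0 c0; have xc : 0 < x / c by rewrite divr_gt0.
have -> : ln x = ln (x / c) + ln c by rewrite -lnM ?posrE// divfK// gt_eqF.
rewrite lerD2r; have := @le_ln1Dx _ (x / c - 1).
by rewrite addrCA subrr addr0; apply; lra.
Qed.

Lemma ln_weighted_mean a b x y z : 0 < a -> 0 < b -> 0 < x -> 0 < y ->
  a * x + b * y <= (a + b) * z -> a * ln x + b * ln y <= (a + b) * ln z.
Proof.
move=> a0 b0 x0 y0 h; have ab0 : 0 < a + b by rewrite addr_gt0.
have z0 : 0 < z.
  by rewrite -(pmulr_rgt0 _ ab0) (lt_le_trans _ h)// addr_gt0// mulr_gt0.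
have hx : a * ln x <= a * (x / z - 1 + ln z) by rewrite ler_pM2l// ln_le_tangent.
have hy : b * ln y <= b * (y / z - 1 + ln z) by rewrite ler_pM2l// ln_le_tangent.
have : (a * x + b * y) / z <= a + b by rewrite ler_pdivrMr.
have -> : (a * x + b * y) / z = a * (x / z) + b * (y / z) by rewrite mulrDl !mulrA.
lra.
Qed.

End logarithm.

(** * The maximum principle on the circle *)
Section cayley.
Variable R : realType.
Implicit Types (z w : C R) (t s : R).

(** The Cayley transform turns the real line into the circle without [z], which
    corresponds to the point at infinity; chords become [|t - s|] up to factors that depend on
    one end only ([dist_cay]). *)
Definition cay z t : C R := z * (Complex t (-1) / Complex t 1).

(** The common modulus of [t + i] and [t - i]. *)
Definition cayn t : R := Num.sqrt (t ^+ 2 + 1).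

Lemma cayn_ge t : `|t| <= cayn t.
Proof. by rewrite -sqrtr_sqr ler_wsqrtr// lerDl. Qed.

Lemma cayn_ge1 t : 1 <= cayn t.
Proof. by rewrite -[leLHS]sqrtr1 ler_wsqrtr// lerDr sqr_ge0. Qed.

Lemma cayn_gt0 t : 0 < cayn t.
Proof. exact: lt_le_trans (cayn_ge1 t). Qed.

Lemma cabs_cayP t : cabs (Complex t 1) = cayn t.
Proof. by rewrite /cabs /= expr1n. Qed.

Lemma cabs_cayM t : cabs (Complex t (-1)) = cayn t.
Proof. by rewrite /cabs /= sqrrN expr1n. Qed.

Lemma cayP_neq0 t : (Complex t 1 : C R) != 0.
Proof. by rewrite -cabs_gt0 cabs_cayP cayn_gt0. Qed.

Lemma cay_circle z t : circle R z -> circle R (cay z t).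
Proof.
rewrite /circle /cay /= => hz; rewrite !cabsM cabsV cabs_cayP cabs_cayM hz mul1r.
by rewrite divff// gt_eqF// cayn_gt0.
Qed.

Lemma dist_cay_base z t : circle R z -> cabs (z - cay z t) = 2 / cayn t.
Proof.
move=> hz; have -> : z - cay z t = z * (Complex 0 2 / Complex t 1).
  rewrite /cay -{1}(mulr1 z) -mulrBr; congr (_ * _).
  apply: (mulIf (cayP_neq0 t)); rewrite mulrBl !divfK ?cayP_neq0// mul1r.
  by simpc; congr Complex; ring.
rewrite !cabsM cabsV cabs_cayP hz mul1r; congr (_ / _).
by rewrite /cabs /= expr0n add0r sqrtr_sqr ger0_norm.
Qed.

Lemma dist_cay z t s : circle R z ->
  cabs (cay z t - cay z s) = 2 * `|t - s| / (cayn t * cayn s).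
Proof.
move=> hz; have -> : cay z t - cay z s =
    z * (Complex 0 (2 * (t - s)) / (Complex t 1 * Complex s 1)).
  rewrite /cay -mulrBr; congr (_ * _).
  apply: (mulIf (mulf_neq0 (cayP_neq0 t) (cayP_neq0 s))).
  rewrite divfK ?mulf_neq0 ?cayP_neq0// mulrBl.
  rewrite [X in X - _]mulrA divfK ?cayP_neq0//.
  rewrite [X in _ - X]mulrCA divfK ?cayP_neq0//.
  by simpc; congr Complex; ring.
rewrite !cabsM cabsV cabsM !cabs_cayP hz mul1r; congr (_ / _).
by rewrite /cabs /= expr0n add0r sqrtr_sqr normrM ger0_norm.
Qed.

(** The inverse transform [i (z + w) / (z - w)] is invariant under conjugation,
    because conjugation inverts [z] and [w]. *)
Lemma cay_surj z w : circle R z -> circle R w -> w != z -> exists t, w = cay z t.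
Proof.
move=> hz hw wz; pose T : C R := Complex 0 1 * ((z + w) / (z - w)).
have z0 := circle_neq0 hz; have w0 := circle_neq0 hw.
have zw0 : z - w != 0 by rewrite subr_eq0 eq_sym.
have Tconj : T^* = T.
  rewrite /T rmorphM rmorphM fmorphV rmorphD rmorphB /= (circle_conj hz) (circle_conj hw).
  have -> : (Complex 0 1 : C R)^* = - Complex 0 1.
    by apply/eqP; rewrite eq_complex /= oppr0 !eqxx.
  rewrite mulNr -mulrN; congr (_ * _).
  field.
  by rewrite z0 w0 zw0 mulN1r subr_eq0 wz.
have [t tE] : exists t, T = t%:C%C.
  move: Tconj; case: (T) => x y /eqP; rewrite eq_complex /= => /andP[_ /eqP h].
  by exists x; congr Complex; lra.
exists t; rewrite /cay; apply: (mulIf (cayP_neq0 t)); rewrite -mulrA divfK ?cayP_neq0//.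
have -> : Complex t 1 = t%:C%C + Complex 0 1 :> C R by simpc.
have -> : Complex t (-1) = t%:C%C - Complex 0 1 :> C R by simpc.
have : t%:C%C * (z - w) = Complex 0 1 * (z + w) by rewrite -tE /T -!mulrA mulVf// mulr1.
set u := t%:C%C; set i := 'i%C => h; apply/eqP; rewrite -subr_eq0.
have -> : w * (u + i) - z * (u - i) = i * (z + w) - u * (z - w) by ring.
by rewrite h subrr.
Qed.

End cayley.

Section maximum_principle.
Variables (R : realType) (rho : probability (borelC R) R) (V : R).
Hypothesis rhoC : rho (~` circle R) = 0%E.
Hypothesis potV : {ae rho, forall z, (pot rho z <= V%:E)%E}.
Implicit Types z w : C R.

Lemma ae_witness (P : borelC R -> Prop) : {ae rho, forall z, P z} -> exists z, P z.
Proof.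
move=> [N [mN N0 hN]]; apply: contrapT => /forallNP nP.
have NT : N = setT by apply/seteqP; split => // z _; apply: hN; exact: nP.
by move: N0; rewrite NT => /eqP; rewrite probability_setT onee_eq0.
Qed.

Section gap.
Variable z0 : C R.
Hypothesis cz0 : circle R z0.
Hypothesis potz0 : ~ (pot rho z0 <= V%:E)%E.

(** By lower semicontinuity the points of the circle with potential at most [V]
    form a closed set; it carries [rho] and misses [z0], so that in the
    Cayley coordinate at [z0] it is a compact set [S], whose extreme points are the
    ends of a gap around [z0]. *)
Let S := [set t : R | (pot rho (cay z0 t) <= V%:E)%E].

Let aeS0 : {ae rho, forall w, exists2 t, S t & w = cay z0 t}.
Proof.
apply: (aeS2 _ (ae_circle rhoC) potV) => w cw pw.
have wz0 : w != z0 by apply/eqP => wz0; apply: potz0; rewrite -wz0.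
by have [t wE] := cay_surj cz0 cw wz0; exists t; rewrite // /S /= -wE.
Qed.

Let S_neq0 : S !=set0.
Proof. by have [w [t St _]] := ae_witness aeS0; exists t. Qed.

Let S_bounded : exists M, forall t, S t -> `|t| <= M.
Proof.
apply: contrapT => /forallNP H; apply: potz0.
have /choice[t tP] : forall n : nat, exists t, S t /\ n.+1%:R < `|t|.
  move=> n; have /existsNP[t /not_implyP[St /negP]] := H n.+1%:R.
  by rewrite -ltNge; exists t.
apply: (@pot_lsc _ _ (fun n => cay z0 (t n))); last by move=> n; case: (tP n).
apply: (@squeeze_cvgr _ _ _ _ (fun=> 0) (fun n : nat => 2 * n.+1%:R^-1)).
- apply: nearW => n; rewrite cabs_ge0 /= cabsC dist_cay_base//.
  rewrite ler_pM2l// lef_pV2 ?posrE ?cayn_gt0 ?ltr0n//.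
  by apply: le_trans (cayn_ge _); apply: ltW; case: (tP n).
- exact: cvg_cst.
- by rewrite -(mulr0 (2 : R)); apply: cvgMr; exact: cvg_harmonic.
Qed.

Let S_closed t : (forall n : nat, exists s, S s /\ `|s - t| <= n.+1%:R^-1) -> S t.
Proof.
move=> /choice[s sP]; have st n := (sP n).2.
apply: (@pot_lsc _ _ (fun n => cay z0 (s n))); last by move=> n; case: (sP n).
apply: (@squeeze_cvgr _ _ _ _ (fun=> 0) (fun n : nat => 2 * n.+1%:R^-1)).
- apply: nearW => n; rewrite cabs_ge0 /= dist_cay//.
  rewrite ler_pdivrMr ?mulr_gt0 ?cayn_gt0// -[leLHS]mulr1.
  apply: ler_pM; rewrite ?mulr_ge0 ?ler_pM2l//.
  by rewrite -[leLHS]mulr1 ler_pM// ?cayn_ge1.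
- exact: cvg_cst.
- by rewrite -(mulr0 (2 : R)); apply: cvgMr; exact: cvg_harmonic.
Qed.

Let extremal : exists a b, [/\ S a, S b & forall t, S t -> a <= t <= b].
Proof.
have [M SM] := S_bounded; have [t0 St0] := S_neq0.
have hs : has_sup S.
  by split=> //; exists M => t /SM; apply: le_trans; exact: ler_norm.
have hi : has_inf S.
  split=> //; exists (- M) => t /SM h.
  by rewrite lerNl; apply: le_trans h; rewrite -normrN ler_norm.
exists (inf S), (sup S); split.
- apply: S_closed => n; have e0 : 0 < n.+1%:R^-1 :> R by rewrite invr_gt0.
  have [t St tlt] := inf_adherent e0 hi; exists t; split=> //.
  by rewrite ger0_norm ?subr_ge0 ?(ge_inf hi.2 St)// lerBlDl ltW.
- apply: S_closed => n; have e0 : 0 < n.+1%:R^-1 :> R by rewrite invr_gt0.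
  have [t St tlt] := sup_adherent e0 hs; exists t; split=> //.
  rewrite ler0_norm ?subr_le0 ?(ub_le_sup hs.2 St)//.
  by rewrite opprB lerBlDl -lerBlDr ltW.
- by move=> t St; rewrite (ge_inf hi.2 St) (ub_le_sup hs.2 St).
Qed.

(** Ptolemy's theorem for [z0], the two ends of the gap and a point [w] of the
    opposite arc: the distance from [z0] to [w] dominates a weighted mean of the
    distances from the ends to [w], and the kernel is a convex decreasing function
    of the distance. *)
Lemma kap_gap a b t : a < b -> a <= t <= b ->
  (kap (cabs (z0 - cay z0 t)) <=
   (cayn a / (cayn a + cayn b))%:E * kap (cabs (cay z0 a - cay z0 t)) +
   (cayn b / (cayn a + cayn b))%:E * kap (cabs (cay z0 b - cay z0 t)))%E.
Proof.
move=> ab /andP[at_ tb].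
have na := cayn_gt0 a; have nb := cayn_gt0 b; have nt := cayn_gt0 t.
have nab : 0 < cayn a + cayn b by rewrite addr_gt0.
have pa : 0 < cayn a / (cayn a + cayn b) by rewrite divr_gt0.
have pb : 0 < cayn b / (cayn a + cayn b) by rewrite divr_gt0.
have kap00 : kap 0 = +oo%E :> \bar R by rewrite /kap lexx.
have pk c d : 0 < c -> (0 <= c%:E * kap d)%E.
  by move=> c0; rewrite mule_ge0 ?kap_ge0// lee_fin ltW.
move: at_ tb; rewrite le_eqVlt => /predU1P[<- _|at_].
  rewrite subrr cabs0 kap00 mulry gtr0_sg// mul1e addye ?leey//.
  by rewrite gt_eqF// (lt_le_trans (ltNyr 0))// pk.
rewrite le_eqVlt => /predU1P[->|tb].
  rewrite subrr cabs0 kap00 mulry gtr0_sg// mul1e addey ?leey//.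
  by rewrite gt_eqF// (lt_le_trans (ltNyr 0))// pk.
have D0 : 0 < cabs (z0 - cay z0 t) by rewrite dist_cay_base// divr_gt0.
have Da : 0 < cabs (cay z0 a - cay z0 t).
  by rewrite dist_cay// divr_gt0 ?mulr_gt0// normr_gt0 subr_eq0 lt_eqF.
have Db : 0 < cabs (cay z0 b - cay z0 t).
  by rewrite dist_cay// divr_gt0 ?mulr_gt0// normr_gt0 subr_eq0 gt_eqF.
have cc := cay_circle _ cz0.
rewrite !kapE ?circle_dist_le2// -!EFinM -EFinD lee_fin.
have H : cayn a * ln (cabs (cay z0 a - cay z0 t)) +
  cayn b * ln (cabs (cay z0 b - cay z0 t)) <= (cayn a + cayn b) * ln (cabs (z0 - cay z0 t)).
  apply: ln_weighted_mean => //.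
  rewrite dist_cay_base// !dist_cay// ltr0_norm ?subr_lt0// gtr0_norm ?subr_gt0//.
  have -> : cayn a * (2 * - (a - t) / (cayn a * cayn t)) +
    cayn b * (2 * (b - t) / (cayn b * cayn t)) = (b - a) * (2 / cayn t).
    by field; rewrite !gt_eqF.
  rewrite ler_pM2r ?divr_gt0//.
  have := cayn_ge a; have := cayn_ge b; rewrite !ler_norml; lra.
rewrite -(ler_pM2l nab) [leRHS]mulrDr ![_ * (_ / _ * _)]mulrA ![_ * (_ / _)]mulrC.
rewrite !divfK ?gt_eqF//; lra.
Qed.

(** Integrating [kap_gap] bounds the potential at [z0] by a mean of its values at
    the ends of the gap, which are at most [V]. If the ends coincide, [rho] is a
    point mass, whose potential is infinite at that point. *)
Lemma gap_contradiction : False.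
Proof.
have [a [b [Sa Sb Sab]]] := extremal.
have := Sab _ Sb => /andP[]; rewrite le_eqVlt => /predU1P[ab _|ab _].
  suff : pot rho (cay z0 a) = +oo%E by move=> h; move: Sa; rewrite /S /= h.
  rewrite /pot (_ : (\int[rho]_w kap (cabs (cay z0 a - w)) = \int[rho]_w (cst +oo w))%E).
    rewrite integral_cst// [X in (_ * X)%E](_ : _ = 1%E) ?mule1//; exact: probability_setT.
  apply: ae_eq_integral => //; first exact: measurable_kap_l.
  apply: (aeS _ aeS0) => _ [t /Sab] + -> _; rewrite -ab => /le_anti <-.
  by rewrite subrr cabs0 /kap lexx.
apply: potz0.
have na := cayn_gt0 a; have nb := cayn_gt0 b.
pose p := cayn a / (cayn a + cayn b); pose q := cayn b / (cayn a + cayn b).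
have p0 : 0 <= p by rewrite divr_ge0// ltW// addr_gt0.
have q0 : 0 <= q by rewrite divr_ge0// ltW// addr_gt0.
have pq : p + q = 1 by rewrite -mulrDl divff// gt_eqF// addr_gt0.
have mk z := measurable_kap_l z; have k0 (z w : C R) := kap_ge0 (cabs (z - w)).
apply: (@le_trans _ _ (\int[rho]_w (p%:E * kap (cabs (cay z0 a - w)) +
                                    q%:E * kap (cabs (cay z0 b - w))))%E).
  apply: ae_ge0_le_integral; [by []|by move=> w _; exact: k0|exact: mk| | |].
  - by move=> w _; rewrite adde_ge0// mule_ge0.
  - by apply: emeasurable_funD; apply: measurable_funeM; exact: mk.
  - by apply: (aeS _ aeS0) => _ [t /Sab tab] -> _; exact: kap_gap.
have ge0s (u : C R) (r : R) : 0 <= r -> forall w : borelC R, setT w ->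
    (0 <= r%:E * kap (cabs (u - w : C R)))%E by move=> r0 w _; rewrite mule_ge0.
rewrite (ge0_integralD rho measurableT (ge0s _ _ p0) (measurable_funeM _ (mk _))
  (ge0s _ _ q0) (measurable_funeM _ (mk _))).
rewrite (ge0_integralZl rho measurableT (mk _))// (ge0_integralZl rho measurableT (mk _))//.
rewrite -[leRHS]mul1e -[in leRHS]pq EFinD ge0_muleDl ?lee_fin//.
have p0' : (0 <= p%:E)%E by rewrite lee_fin.
have q0' : (0 <= q%:E)%E by rewrite lee_fin.
exact: (leeD (lee_wpmul2l p0' Sa) (lee_wpmul2l q0' Sb)).
Qed.

End gap.

Lemma max_circle z : circle R z -> (pot rho z <= V%:E)%E.
Proof. by move=> cz; apply: contrapT => /(gap_contradiction cz). Qed.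

End maximum_principle.

(** * Polynomials and the maximum principle in the disc *)
Section polynomial_potentials.
Variable R : realType.
Implicit Types (z w : C R) (r : seq (C R)).

Lemma sum_kapE r w : (forall z, z \in r -> cabs (z - w) <= 2) ->
  (\sum_(z <- r) kap (cabs (z - w)) =
   if (0 < \prod_(z <- r) cabs (z - w))%R
   then ((size r)%:R * ln 2 - ln (\prod_(z <- r) cabs (z - w)))%:E else +oo)%E.
Proof.
elim: r => [|z r IH] hr; first by rewrite !big_nil ltr01 mul0r ln1 subr0.
rewrite !big_cons IH; last by move=> u ur; apply: hr; rewrite inE ur orbT.
have := cabs_ge0 (z - w); rewrite le_eqVlt => /predU1P[h|h].
  rewrite -h mul0r ltxx /kap lexx addye//; case: ifP => //.
rewrite pmulr_rgt0// kapE//; last by apply: hr; rewrite inE eqxx.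
case: ifP => [p0|//]; rewrite -EFinD lnM ?posrE//=.
by congr EFin; rewrite -[(size r).+1%:R]natr1; ring.
Qed.

(** For [z] in the disc this compares the numerator and the denominator of the
    Blaschke factor [(w - z) / (1 - z^* w)]: its modulus is [1] only on the
    circle. *)
Lemma cabs_mobius z w : cabs (1 - z^* * w) ^+ 2 - cabs (w - z) ^+ 2 =
  (1 - cabs z ^+ 2) * (1 - cabs w ^+ 2).
Proof.
rewrite !cabs_sqr; case: z => a b; case: w => x y.
have -> : (Complex a b : C R)^* = Complex a (- b) by [].
simpc => /=; ring.
Qed.

Lemma coef_binomial_top (c : C R) (n : nat) :
  (size ((c *: 'X + 1 : {poly C R}) ^+ n)%R <= n.+1)%N /\
  ((c *: 'X + 1 : {poly C R}) ^+ n)`_n = c ^+ n.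
Proof.
elim: n => [|n [IHs IHc]]; first by rewrite !expr0 size_poly1 coef1.
have s2 : (size (c *: 'X + 1 : {poly C R})%R <= 2)%N.
  rewrite (leq_trans (size_polyD _ _))// geq_max size_poly1 andbT.
  by rewrite (leq_trans (size_scale_leq _ _))// size_polyX.
rewrite exprS; split.
  apply: leq_trans (size_polyMleq _ _) _.
  by rewrite -subn1 leq_subLR add1n; exact: (leq_add s2 IHs).
rewrite mulrDl mul1r coefD -scalerAl coefZ coefXM /= IHc.
by rewrite (nth_default _ (IHs : (_ <= n.+1)%N)) addr0 exprS.
Qed.

(** For [z] in the disc, the [n]-th power of the Blaschke factor at [z] takes the
    value [1] at [n] points of the circle, and these are nearly distributed
    according to the harmonic measure of [z]: they are the zeros of
    [(w - z)^n - (1 - z^* w)^n], whose modulus on the circle is at most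
    [2 |w - z|^n]. *)
Lemma blaschke_points z n : cabs z < 1 -> (0 < n)%N ->
  exists r, [/\ size r = n, forall u, u \in r -> circle R u &
    forall w, circle R w ->
      \prod_(u <- r) cabs (u - w) <= 2 / (1 - cabs z) * cabs (w - z) ^+ n].
Proof.
move=> z1 n0.
have ez : 0 < 1 - cabs z ^+ 2 by rewrite subr_gt0 expr_lt1// cabs_ge0.
pose B : {poly C R} := (- z^*) *: 'X + 1.
pose Q := ('X - z%:P) ^+ n - B ^+ n.
have [sB cB] := coef_binomial_top (- z^*) n.
have sA : size (('X - z%:P) ^+ n) = n.+1 by rewrite size_exp_XsubC.
have cQ : Q`_n = 1 - (- z^*) ^+ n.
  rewrite /Q coefB cB; congr (_ - _).
  have /monicP : ('X - z%:P) ^+ n \is monic by rewrite monic_exp// monicXsubC.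
  by rewrite lead_coefE sA.
have cQ0 : 1 - cabs z <= cabs (Q`_n).
  have : cabs (1 : C R) <= cabs (Q`_n) + cabs ((- z^*) ^+ n).
    by rewrite cQ; apply: le_trans (ler_cabsD _ _); rewrite subrK.
  rewrite cabs1 cabsX cabsN cabs_conj => h.
  have : cabs z ^+ n <= cabs z.
    by rewrite -[leRHS]expr1 ler_wiXn2l// ?cabs_ge0// ltW.
  by move: h; lra.
have c0 : 0 < cabs (Q`_n) by apply: lt_le_trans cQ0; rewrite subr_gt0.
have sQ : size Q = n.+1.
  apply/eqP; rewrite eqn_leq; apply/andP; split.
    by rewrite (leq_trans (size_polyD _ _))// size_polyN geq_max sA leqnn.
  rewrite ltnNge; apply/negP => h.
  by move: c0; rewrite (nth_default _ h) cabs0 ltxx.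
have lQ : lead_coef Q = Q`_n by rewrite lead_coefE sQ.
have [r rQ] := closed_field_poly_normal Q.
have Q0 : lead_coef Q != 0 by rewrite lQ -cabs_gt0.
have hB u : B.[u] = 1 - z^* * u by rewrite /B hornerD hornerZ hornerX hornerC mulNr addrC.
have hQ u : Q.[u] = (u - z) ^+ n - (1 - z^* * u) ^+ n.
  by rewrite /Q hornerD hornerN !horner_exp hornerXsubC hB.
exists r; split.
- apply/eqP; rewrite -eqSS -sQ rQ size_scale// size_prod_XsubC//.
- move=> u ur; have /rootP : root Q u by rewrite rQ rootZ// root_prod_XsubC.
  rewrite hQ => /eqP; rewrite subr_eq0 => /eqP /(congr1 (@cabs R)).
  rewrite !cabsX => /eqP; rewrite eqrXn2 ?cabs_ge0// => /eqP h.
  have := cabs_mobius z u; rewrite h subrr => /esym/eqP.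
  rewrite mulf_eq0 gt_eqF//= subr_eq0 eq_sym sqrp_eq1 ?cabs_ge0// => /eqP; exact.
- move=> w cw; have e1 : cabs (1 - z^* * w) = cabs (w - z).
    apply/eqP; rewrite -(@eqrXn2 _ 2)// ?cabs_ge0// -subr_eq0 cabs_mobius cw.
    by rewrite expr1n subrr mulr0.
  have h1 : cabs Q.[w] <= 2 * cabs (w - z) ^+ n.
    rewrite hQ; apply: le_trans (ler_cabsD _ _) _.
    by rewrite cabsN !cabsX e1 mulr_natl mulr2n.
  have h2 : cabs Q.[w] = cabs (Q`_n) * \prod_(u <- r) cabs (u - w).
    rewrite {1}rQ hornerZ cabsM lQ horner_prod cabs_prod; congr (_ * _).
    by apply: eq_bigr => u _; rewrite hornerXsubC cabsC.
  have h3 : \prod_(u <- r) cabs (u - w) <= 2 * cabs (w - z) ^+ n / cabs (Q`_n).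
    by rewrite ler_pdivlMr// mulrC -h2.
  apply: (le_trans h3); rewrite mulrAC ler_wpM2r ?exprn_ge0 ?cabs_ge0//.
  by rewrite ler_pM2l// lef_pV2 ?posrE// subr_gt0.
Qed.

(** Reflecting the zeros outside the closed disc in the circle only makes a monic
    polynomial smaller on the circle. *)
Lemma monic_zeros_in_disc (p : {poly C R}) n : p \is monic -> size p = n.+1 ->
  exists r, [/\ size r = n, forall u, u \in r -> cabs u <= 1 &
    forall w, circle R w -> \prod_(u <- r) cabs (u - w) <= cabs p.[w]].
Proof.
move=> /monicP pm sp; have [r rp] := closed_field_poly_normal p.
rewrite pm scale1r in rp.
pose f z := if cabs z <= 1 then z else (z^*)^-1.
exists (map f r); split.
- by apply/eqP; rewrite size_map -eqSS -sp rp size_prod_XsubC.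
- move=> _ /mapP[u ur ->]; rewrite /f; case: ifPn => //; rewrite -ltNge => u1.
  by rewrite cabsV cabs_conj invf_le1 ?ltW// (lt_trans ltr01).
- move=> w cw; rewrite big_map rp horner_prod cabs_prod.
  apply: ler_prod => u _; rewrite cabs_ge0 /= hornerXsubC [leRHS]cabsC /f.
  case: ifPn => //; rewrite -ltNge => u1.
  have u0 : u != 0 by rewrite -cabs_gt0 (lt_trans ltr01).
  have w0 := circle_neq0 cw.
  have -> : cabs ((u^*)^-1 - w) = cabs (u - w) / cabs u.
    rewrite -[LHS]cabs_conj rmorphB fmorphV /= conjCK (circle_conj cw).
    rewrite (_ : u^-1 - w^-1 = - ((u - w) / u / w)); last first.
      by field; rewrite u0 w0.
    by rewrite cabsN cabsM cabsV cw invr1 mulr1 cabsM cabsV.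
  by rewrite ler_pdivrMr ?(lt_trans ltr01)// ler_peMr ?cabs_ge0// ltW.
Qed.

End polynomial_potentials.

Section potential_disc.
Variables (R : realType) (rho : probability (borelC R) R) (V : R).
Hypothesis rhoC : rho (~` circle R) = 0%E.
Hypothesis potV : {ae rho, forall z, (pot rho z <= V%:E)%E}.
Implicit Types z w : C R.

Let V0 : 0 <= V.
Proof.
have [z] := ae_witness potV; rewrite -lee_fin; apply: le_trans; exact: pot_ge0.
Qed.

Lemma measurable_sum_kap (r : seq (C R)) :
  measurable_fun setT ((fun w => \sum_(z <- r) kap (cabs (z - w)))%E : borelC R -> \bar R).
Proof. by apply: emeasurable_sum => z; exact: measurable_kap_l. Qed.

Lemma sum_kap_ge0 (r : seq (C R)) w : (0 <= \sum_(z <- r) kap (cabs (z - w)))%E.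
Proof. by apply: sume_ge0 => z _; exact: kap_ge0. Qed.

Lemma integral_sum_kap (r : seq (C R)) :
  (forall z, z \in r -> (pot rho z <= V%:E)%E) ->
  (\int[rho]_w \sum_(z <- r) kap (cabs (z - w)) <= ((size r)%:R * V)%:E)%E.
Proof.
move=> hr; rewrite ge0_integral_sum//; last 2 first.
- by move=> z; exact: measurable_kap_l.
- by move=> z w _; exact: kap_ge0.
elim: r hr => [|z r IH] hr; first by rewrite big_nil mul0r.
rewrite big_cons /= -[(size r).+1%:R]natr1 mulrDl mul1r EFinD [leRHS]addeC.
apply: leeD; first by apply: hr; rewrite inE eqxx.
by apply: IH => u ur; apply: hr; rewrite inE ur orbT.
Qed.

(** Up to a constant [c] independent of [n], the kernel at [z] is at most the mean
    of the kernels at [n] Blaschke points plus [c / n], and at those points of the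
    circle the potential is at most [V]. *)
Lemma max_disc z : cabs z < 1 -> (pot rho z <= V%:E)%E.
Proof.
move=> z1; pose c := Num.max 0 (ln (2 / (1 - cabs z))).
have c0 : 0 <= c by rewrite le_max lexx.
have K0 : 0 < 2 / (1 - cabs z) by rewrite divr_gt0// subr_gt0.
have H n : (n.+1%:R%:E * pot rho z <= (n.+1%:R * V + c)%:E)%E.
  have [r [sr rC hr]] := blaschke_points z1 (ltn0Sn n).
  rewrite /pot -ge0_integralZl//; last 2 first.
  - exact: measurable_kap_l.
  - by move=> w _; exact: kap_ge0.
  apply: (@le_trans _ _ (\int[rho]_w (\sum_(u <- r) kap (cabs (u - w)) + cst c%:E w))%E).
    apply: ae_ge0_le_integral.
    - by [].
    - by move=> w _; rewrite mule_ge0// kap_ge0.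
    - by apply: measurable_funeM; exact: measurable_kap_l.
    - by move=> w _; rewrite adde_ge0 ?lee_fin// sum_kap_ge0.
    - by apply: emeasurable_funD => //; exact: measurable_sum_kap.
    apply: (aeS _ (ae_circle rhoC)) => w cw _ /=.
    have d0 : 0 < cabs (z - w).
      rewrite cabs_gt0 subr_eq0; apply/eqP => zw; move: z1; rewrite zw cw ltxx//.
    rewrite sum_kapE; last by move=> u /rC cu; exact: circle_dist_le2.
    case: ifPn => [p0|_]; last by rewrite addye// leey.
    rewrite kapE//; last first.
      by apply: (le_trans (ler_cabsD _ _)); rewrite cabsN cw; lra.
    rewrite -EFinM -EFinD lee_fin sr mulrBr -addrA lerD2l.
    have : ln (\prod_(u <- r) cabs (u - w)) <= ln (2 / (1 - cabs z) * cabs (w - z) ^+ n.+1).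
      by rewrite ler_ln ?posrE// ?hr// mulr_gt0// exprn_gt0// cabsC.
    rewrite lnM ?posrE// ?exprn_gt0 1?cabsC// lnXn// -[X in _ + X]mulr_natl => h.
    have : ln (2 / (1 - cabs z)) <= c by rewrite /c le_max lexx orbT.
    move: h; set m := _.+1%:R; set l := ln _ => h h2; lra.
  rewrite ge0_integralD//; last 2 first.
  - by move=> w _; exact: sum_kap_ge0.
  - exact: measurable_sum_kap.
  rewrite EFinD; apply: leeD.
    by rewrite -sr; apply: integral_sum_kap => u /rC cu; exact: max_circle.
  rewrite integral_cst// [X in (_ * X)%E](_ : _ = 1%E) ?mule1//; exact: probability_setT.
have [u uE] : exists u, pot rho z = u%:E.
  have := H 0; case: (pot rho z) (pot_ge0 rho z) => [u _ _|_|//]; first by exists u.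
  by rewrite gt0_muley ?lte_fin// leye_eq.
rewrite uE lee_fin leNgt; apply/negP => uV.
have [n hn] : exists n : nat, c / (u - V) < n%:R.
  by exists (Num.truncn (c / (u - V))).+1; exact: truncnS_gt.
have uV0 : 0 < u - V by rewrite subr_gt0.
have := H n; rewrite uE -EFinM lee_fin.
move: hn; rewrite ltr_pdivrMr// -[n.+1%:R]natr1 => h1 h2.
lra.
Qed.

(** The integral of [n ln 2 - ln |p|] is at most [n V], as a sum of potentials of
    [rho] at the zeros of [p], once these are reflected into the disc. The bound is
    recorded through a nonnegative majorant [G], which may be infinite, so that no
    integrability of [ln |p|] has to be discussed. *)
Lemma log_polynomial_integral (p : {poly C R}) n : p \is monic -> size p = n.+1 ->
  exists G : borelC R -> \bar R, [/\ measurable_fun setT G, forall w, (0 <= G w)%E,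
    (\int[rho]_w G w <= (n%:R * V)%:E)%E &
    forall w, circle R w -> G w = +oo%E \/
      0 < cabs p.[w] /\ ((n%:R * ln 2 - ln (cabs p.[w]))%:E <= G w)%E].
Proof.
move=> pm sp; have [r [sr r1 hr]] := monic_zeros_in_disc pm sp.
exists (fun w => \sum_(z <- r) kap (cabs (z - w)))%E; split.
- exact: measurable_sum_kap.
- exact: sum_kap_ge0.
- rewrite -sr; apply: integral_sum_kap => z /r1.
  by rewrite le_eqVlt => /predU1P[|]; [exact: max_circle|exact: max_disc].
- move=> w cw; rewrite sum_kapE; last first.
    move=> u /r1 u1; apply: (le_trans (ler_cabsD _ _)); rewrite cabsN cw; lra.
  case: ifPn => [p0|_]; [right|by left].
  have pw0 : 0 < cabs p.[w] by apply: lt_le_trans (hr _ cw).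
  by split => //; rewrite lee_fin sr lerD2l lerN2 ler_ln ?posrE// hr.
Qed.

End potential_disc.

(** * Lower bounds for monic polynomials in L^2 *)
Section lower_bound.
Variables (R : realType) (rho : probability (borelC R) R) (V : R).
Hypothesis rhoC : rho (~` circle R) = 0%E.
Hypothesis potV : {ae rho, forall z, (pot rho z <= V%:E)%E}.
Variable mu : {measure set (borelC R) -> \bar R}.

Lemma le_integral_of_density (A : set (borelC R)) (de : R) (g : borelC R -> \bar R) :
  measurable A -> 0 <= de ->
  (forall B, measurable B -> B `<=` A -> (de%:E * rho B <= mu B)%E) ->
  measurable_fun setT g -> (forall z, 0 <= g z)%E ->
  (de%:E * \int[rho]_(z in A) g z <= \int[mu]_z g z)%E.
Proof.
move=> mA de0 hA mg g0; pose d' := NngNum de0.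
have -> : (de%:E * \int[rho]_(z in A) g z = \int[mscale d' rho]_(z in A) g z)%E.
  by rewrite ge0_integral_mscale//; exact: measurable_funTS.
apply: (@le_trans _ _ (\int[mu]_(z in A) g z)%E); last exact: ge0_subset_integral.
rewrite -!(ge0_integral_mrestr _ mA)//.
apply: ge0_le_measure_integral => //.
move=> B mB; rewrite /= /mrestr /mscale /=; apply: hA => //.
exact: measurableI.
Qed.

(** If [mu] dominates a multiple of [rho] on a set [A], a monic polynomial cannot
    be small in [L^2(mu)]: its logarithm has a [rho]-integral bounded from below,
    and on [A] it lies below a tangent line of the logarithm at [c]. *)
Lemma monic_L2_lower_bound (A : set (borelC R)) (de a B c x : R) (p : {poly C R}) n :
  measurable A -> 0 < de ->
  (forall B, measurable B -> B `<=` A -> (de%:E * rho B <= mu B)%E) ->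
  rho A = a%:E -> 1 <= B -> 0 < c -> p \is monic -> size p = n.+1 ->
  (forall w, circle R w -> cabs p.[w] <= B) ->
  (\int[mu]_z (cabs p.[z] ^+ 2)%:E <= x%:E)%E ->
  2 * n%:R * ln 2 - 2 * n%:R * V <= x / (de * c) + a * (ln c - 1) + 2 * (1 - a) * ln B.
Proof.
move=> mA de0 hA rA B1 c0 pm sp pB px.
have [G [mG G0 iG hG]] := log_polynomial_integral rhoC potV pm sp.
have mCA : measurable (~` A) by exact: measurableC.
have fin_le (y : \bar R) (z : R) : (0 <= y)%E -> (y <= z%:E)%E -> exists2 r, y = r%:E & r <= z.
  by case: y => [r||]//= _ h; exists r; rewrite -?lee_fin.
have GD (D : set (borelC R)) : measurable D ->
    exists g, (\int[rho]_(z in D) G z)%E = g%:E.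
  move=> mD; have h0 : (0 <= \int[rho]_(z in D) G z)%E by apply: integral_ge0 => z _; exact: G0.
  have h1 : (\int[rho]_(z in D) G z <= (n%:R * V)%:E)%E.
    by apply: le_trans iG; apply: ge0_subset_integral.
  by have [g -> _] := fin_le _ _ h0 h1; exists g.
have [gA gAE] := GD _ mA; have [gB gBE] := GD _ mCA.
have gAB : gA + gB <= n%:R * V.
  rewrite -lee_fin EFinD -gAE -gBE -ge0_integral_setU ?setUv//.
  by apply/disj_setPS; rewrite setICr.
have a0 : 0 <= a by rewrite -lee_fin -rA.
have mp : measurable_fun setT (fun z : borelC R => (cabs p.[z] ^+ 2)%:E).
  by apply/measurable_EFinP; apply: measurable_funX; exact: measurable_poly_cabs.
have p0 (z : borelC R) : (0 <= (cabs p.[z] ^+ 2)%:E)%E by rewrite lee_fin sqr_ge0.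
have [q qE dq] : exists2 q, (\int[rho]_(z in A) (cabs p.[z] ^+ 2)%:E)%E = q%:E & q <= x / de.
  apply: fin_le; first by apply: integral_ge0 => z _; exact: p0.
  have dn : de != 0 by rewrite gt_eqF.
  rewrite mulrC -[leLHS]mul1e -[1%E]/(1%:E) -(mulVf dn) 2!EFinM -muleA.
  apply: lee_wpmul2l; first by rewrite lee_fin invr_ge0 ltW.
  by apply: le_trans px; apply: le_integral_of_density => //; exact: ltW.
have step (D : set (borelC R)) (k K d g hh : R) (h : borelC R -> \bar R) :
    measurable D -> rho D = d%:E -> 0 <= k -> 0 <= K ->
    (\int[rho]_(z in D) G z)%E = g%:E ->
    measurable_fun setT h -> (forall z, 0 <= h z)%E ->
    (\int[rho]_(z in D) h z)%E = hh%:E ->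
    (forall z, circle R z -> D z -> (k%:E <= 2%:E * G z + h z + K%:E)%E) ->
    k * d <= 2 * g + hh + K * d.
  move=> mD rD k0 K0 gE mh h0 hE H.
  have mDG : measurable_fun D (fun z => 2%:E * G z)%E.
    by apply: measurable_funeM; exact: measurable_funTS.
  have mDh : measurable_fun D h by exact: measurable_funTS.
  have G20 z : D z -> (0 <= 2%:E * G z)%E by move=> _; rewrite mule_ge0// lee_fin.
  have Gh0 z : D z -> (0 <= 2%:E * G z + h z)%E by move=> Dz; rewrite adde_ge0 ?G20.
  have i1 : (\int[rho]_(z in D) cst k%:E z = (k * d)%:E)%E.
    by rewrite integral_cst// EFinM -rD.
  have i2 : (\int[rho]_(z in D) (2%:E * G z + h z + cst K%:E z) = (2 * g + hh + K * d)%:E)%E.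
    rewrite (ge0_integralD rho mD Gh0 (emeasurable_funD mDG mDh))//.
    rewrite (ge0_integralD rho mD G20 mDG _ mDh)//.
    rewrite (ge0_integralZl rho mD (measurable_funTS mG))//.
    by rewrite gE hE integral_cst// !EFinD !EFinM -rD.
  rewrite -lee_fin -i1 -i2; apply: ae_ge0_le_integral => //.
  - by move=> z Dz; rewrite adde_ge0 ?Gh0 ?lee_fin.
  - by apply: emeasurable_funD => //; exact: emeasurable_funD.
  - by apply: (aeS _ (ae_circle rhoC)) => z cz Dz; exact: H.
have rCA : rho (~` A) = (1 - a)%:E by rewrite probability_setC// rA.
have n0 : 0 <= 2 * n%:R * ln 2 :> R by rewrite !mulr_ge0// ln_ge0// ler1n.
(* Adding [K] on both sides of the tangent inequality keeps the integrands
   nonnegative. *)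
pose K := `|ln c - 1|.
have HK : ln c - 1 <= K by exact: ler_norm.
have HA := step A (2 * n%:R * ln 2 + (1 - ln c + K)) K a gA (c^-1 * q)
   (fun z => (c^-1)%:E * (cabs p.[z] ^+ 2)%:E)%E mA rA _ (normr_ge0 _) gAE.
have HB := step (~` A) (2 * n%:R * ln 2) (2 * ln B) (1 - a) gB 0
   (cst 0)%E mCA rCA n0 _ gBE.
have lnB0 : 0 <= ln B by rewrite ln_ge0.
have {}HA : (2 * n%:R * ln 2 + (1 - ln c + K)) * a <= 2 * gA + c^-1 * q + K * a.
  apply: HA.
  - by rewrite addr_ge0//; lra.
  - exact: measurable_funeM.
  - by move=> z; rewrite mule_ge0// lee_fin invr_ge0 ltW.
  - rewrite (ge0_integralZl rho mA (measurable_funTS mp))// ?qE//.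
    by rewrite lee_fin invr_ge0 ltW.
  - move=> z cz Az; case: (hG _ cz) => [->|[pz0 hz]].
      by rewrite gt0_muley ?lte_fin// -addeA addye ?leey// -EFinM -EFinD.
    move: hz (G0 z); case: (G z) => [g| |//] ; last first.
      by rewrite gt0_muley ?lte_fin// -addeA addye ?leey// -EFinM -EFinD.
    rewrite -!EFinM -!EFinD !lee_fin => hz _.
    have := ln_le_tangent (exprn_gt0 2 pz0) c0.
    by rewrite lnXn// mulr2n [_ / c]mulrC; lra.
have {}HB : (2 * n%:R * ln 2) * (1 - a) <= 2 * gB + 0 + 2 * ln B * (1 - a).
  apply: HB => //.
  - by rewrite mulr_ge0.
  - by rewrite integral0.
  - move=> z cz Az; case: (hG _ cz) => [->|[pz0 hz]].
      by rewrite gt0_muley ?lte_fin// adde0 addye ?leey.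
    move: hz (G0 z); case: (G z) => [g| |//] ; last first.
      by rewrite gt0_muley ?lte_fin// adde0 addye ?leey.
    rewrite /cst adde0 -!EFinM -!EFinD !lee_fin => hz _.
    have : ln (cabs p.[z]) <= ln B by rewrite ler_ln ?posrE ?pB// (lt_le_trans ltr01).
    lra.
have hq : c^-1 * q <= x / (de * c).
  by rewrite invfM mulrA mulrC ler_pM2r ?invr_gt0.
lra.
Qed.
End lower_bound.

(** * Orthogonal polynomials *)
Section inner_product.
Variables (R : realType) (mu : {finite_measure set (borelC R) -> \bar R}).
Hypothesis muC : mu (~` circle R) = 0%E.
Implicit Types (p q : {poly C R}) (z w c : C R) (g h : borelC R -> R).

Definition bdd_on_circle g :=
  measurable_fun setT g /\ exists M, forall z, circle R z -> `|g z| <= M.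

Lemma bdd_on_circle_integrable g : bdd_on_circle g -> mu.-integrable setT (EFin \o g).
Proof.
move=> [mg [M gM]]; apply/integrableP; split; first exact/measurable_EFinP.
apply: (@le_lt_trans _ _ (\int[mu]_z (cst (Num.max 0 M)%:E z))%E).
  apply: ae_ge0_le_integral => //.
  - by apply/measurable_EFinP/measurableT_comp.
  - by move=> z _; rewrite lee_fin le_max lexx.
  - by apply: (aeS _ (ae_circle muC)) => z cz _; rewrite /= lee_fin le_max gM ?orbT.
rewrite integral_cst// lte_mul_pinfty// ?lee_fin ?le_max ?lexx//.
by rewrite ltey_eq fin_num_measure.
Qed.

Lemma bdd_on_circleD g h : bdd_on_circle g -> bdd_on_circle h -> bdd_on_circle (fun z => g z + h z).
Proof.
move=> [mg [M gM]] [mh [N hN]]; split; first exact: measurable_funD.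
exists (M + N) => z cz; apply: le_trans (ler_normD _ _) _.
by rewrite lerD ?gM ?hN.
Qed.

Lemma bdd_on_circleM g h : bdd_on_circle g -> bdd_on_circle h -> bdd_on_circle (fun z => g z * h z).
Proof.
move=> [mg [M gM]] [mh [N hN]]; split; first exact: measurable_funM.
by exists (M * N) => z cz; rewrite normrM ler_pM ?gM ?hN.
Qed.

Lemma bdd_on_circle_cst (r : R) : bdd_on_circle (fun=> r).
Proof. by split; [exact: measurable_cst|exists `|r|]. Qed.

Definition cbdd_on_circle (f : C R -> C R) :=
  bdd_on_circle (fun z => complex.Re (f z)) /\ bdd_on_circle (fun z => complex.Im (f z)).

Lemma cintegralD (f g : C R -> C R) : cbdd_on_circle f -> cbdd_on_circle g ->
  cintegral mu (fun z => f z + g z) = cintegral mu f + cintegral mu g.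
Proof.
move=> [f1 f2] [g1 g2]; rewrite /cintegral.
under [X in Complex X _]eq_Rintegral do rewrite raddfD /=.
under [X in Complex _ X]eq_Rintegral do rewrite raddfD /=.
by rewrite !RintegralD//; exact: bdd_on_circle_integrable.
Qed.

Lemma cintegralZ c (f : C R -> C R) : cbdd_on_circle f ->
  cintegral mu (fun z => c * f z) = c * cintegral mu f.
Proof.
move=> [f1 f2]; rewrite /cintegral.
have h (r : R) g : bdd_on_circle g -> bdd_on_circle (fun z => r * g z).
  by move=> ng; exact: bdd_on_circleM (bdd_on_circle_cst r) ng.
have E z : c * f z = Complex (complex.Re c * complex.Re (f z) + (- complex.Im c) * complex.Im (f z))
   (complex.Re c * complex.Im (f z) + complex.Im c * complex.Re (f z)).
  by case: c (f z) => a b [x y]; simpc; rewrite ?mulNr.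
under [X in Complex X _]eq_Rintegral do rewrite E /=.
under [X in Complex _ X]eq_Rintegral do rewrite E /=.
have i1 := bdd_on_circle_integrable f1; have i2 := bdd_on_circle_integrable f2.
rewrite !RintegralD ?RintegralZl//; try exact: bdd_on_circle_integrable (h _ _ _).
case: c {E} => a b /=; simpc; by rewrite ?mulNr.
Qed.

Lemma poly_bounded p : exists2 M, 0 <= M & forall z, circle R z -> cabs p.[z] <= M.
Proof.
exists (\sum_(i < size p) cabs p`_i); first by apply: sumr_ge0 => i _; exact: cabs_ge0.
move=> z cz; rewrite horner_coef.
elim/big_ind2 : _ => [|u a v b ua vb|i _]; first by rewrite cabs0.
- by apply: le_trans (ler_cabsD _ _) _; rewrite lerD.
- by rewrite cabsM cabsX cz expr1n mulr1.
Qed.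

Lemma bdd_on_circle_Re p : bdd_on_circle (fun z => complex.Re p.[z]).
Proof.
split; first by have [] := measurable_poly_ReIm p.
by have [M _ pM] := poly_bounded p; exists M => z /pM; apply: le_trans; exact: ler_Re_cabs.
Qed.

Lemma bdd_on_circle_Im p : bdd_on_circle (fun z => complex.Im p.[z]).
Proof.
split; first by have [] := measurable_poly_ReIm p.
by have [M _ pM] := poly_bounded p; exists M => z /pM; apply: le_trans; exact: ler_Im_cabs.
Qed.

Definition inner p q : C R := cintegral mu (fun z => (p.[z])^* * q.[z]).

Lemma cbdd_on_circle_inner p q : cbdd_on_circle (fun z => (p.[z])^* * q.[z]).
Proof.
have E z : (p.[z])^* * q.[z] = Complex
   (complex.Re p.[z] * complex.Re q.[z] + complex.Im p.[z] * complex.Im q.[z])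
   (complex.Re p.[z] * complex.Im q.[z] + -1 * (complex.Im p.[z] * complex.Re q.[z])).
  case: (p.[z]) (q.[z]) => a b [x y]; rewrite (_ : (Complex a b : C R)^* = Complex a (- b))//.
  by simpc; rewrite ?mulNr ?opprK ?mul1r.
split; under eq_fun do rewrite E /=.
- by apply: bdd_on_circleD; apply: bdd_on_circleM; by [exact: bdd_on_circle_Re|exact: bdd_on_circle_Im].
- apply: bdd_on_circleD; first by apply: bdd_on_circleM; [exact: bdd_on_circle_Re|exact: bdd_on_circle_Im].
  apply: bdd_on_circleM; first exact: bdd_on_circle_cst.
  by apply: bdd_on_circleM; [exact: bdd_on_circle_Im|exact: bdd_on_circle_Re].
Qed.

Lemma innerDr p q1 q2 : inner p (q1 + q2) = inner p q1 + inner p q2.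
Proof.
rewrite /inner -cintegralD; try exact: cbdd_on_circle_inner.
by congr cintegral; apply/funext => z; rewrite hornerD mulrDr.
Qed.

Lemma innerDl p1 p2 q : inner (p1 + p2) q = inner p1 q + inner p2 q.
Proof.
rewrite /inner -cintegralD; try exact: cbdd_on_circle_inner.
by congr cintegral; apply/funext => z; rewrite hornerD rmorphD mulrDl.
Qed.

Lemma innerZl c p q : inner (c *: p) q = c^* * inner p q.
Proof.
rewrite /inner -cintegralZ; last exact: cbdd_on_circle_inner.
by congr cintegral; apply/funext => z; rewrite hornerZ rmorphM mulrA.
Qed.

Lemma inner_conj p q : (inner p q)^* = inner q p.
Proof.
have [h1 h2] := cbdd_on_circle_inner p q.
have E z : (q.[z])^* * p.[z] = Complex (complex.Re ((p.[z])^* * q.[z]))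
    (-1 * complex.Im ((p.[z])^* * q.[z])).
  case: (p.[z]) (q.[z]) => a b [x y].
  rewrite (_ : (Complex a b : C R)^* = Complex a (- b))//.
  rewrite (_ : (Complex x y : C R)^* = Complex x (- y))//.
  by simpc; congr Complex => /=; ring.
rewrite /inner /cintegral.
under [X in _ = Complex X _]eq_Rintegral do rewrite E /=.
under [X in _ = Complex _ X]eq_Rintegral do rewrite E /=.
by rewrite RintegralZl//; [rewrite mulN1r|exact: bdd_on_circle_integrable].
Qed.

Lemma inner_orthogonal Phi n : monic_OP mu n Phi ->
  forall p, (size p <= n)%N -> inner p Phi = 0.
Proof.
move=> [_ _ H]; have H' j : (j < n)%N -> inner 'X^j Phi = 0.
  by move=> /H <-; congr cintegral; apply/funext => z; rewrite hornerXn.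
move=> p sp; rewrite -(coefK p) poly_def.
have : forall m, (m <= n)%N -> inner (\sum_(i < m) p`_i *: 'X^i) Phi = 0.
  elim=> [_|m IH mn].
    by rewrite big_ord0 -(scale0r 0) innerZl conjC0 mul0r.
  by rewrite big_ord_recr /= innerDl (IH (ltnW mn)) innerZl (H' _ mn) mulr0 addr0.
by apply.
Qed.

Definition L2sq p : R := \int[mu]_z (cabs p.[z] ^+ 2).

Lemma bdd_on_circle_cabs2 p : bdd_on_circle (fun z => cabs p.[z] ^+ 2).
Proof.
have E z : cabs p.[z] ^+ 2 = complex.Re p.[z] * complex.Re p.[z] + complex.Im p.[z] * complex.Im p.[z].
  by rewrite cabs_sqr !expr2.
under eq_fun do rewrite E.
by apply: bdd_on_circleD; apply: bdd_on_circleM; by [exact: bdd_on_circle_Re|exact: bdd_on_circle_Im].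
Qed.

Lemma L2sqE p : (\int[mu]_z (cabs p.[z] ^+ 2)%:E)%E = (L2sq p)%:E.
Proof.
rewrite /L2sq /Rintegral fineK//; apply: integrable_fin_num => //.
exact: (bdd_on_circle_integrable (bdd_on_circle_cabs2 p)).
Qed.

Lemma L2sq_ge0 p : 0 <= L2sq p.
Proof. by apply: Rintegral_ge0 => z _; rewrite sqr_ge0. Qed.

Lemma inner_self p : inner p p = (L2sq p)%:C%C.
Proof.
rewrite /inner /cintegral /L2sq; under eq_fun do rewrite conj_mulC /=.
rewrite [X in Complex _ X](_ : _ = 0); last first.
  by under eq_Rintegral do rewrite conj_mulC /=; rewrite Rintegral_cst// mul0r.
by congr Complex; apply: eq_Rintegral => z _; rewrite conj_mulC.
Qed.

Lemma pythagoras p q : inner p q = 0 -> L2sq (p + q) = L2sq p + L2sq q.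
Proof.
move=> pq; have qp : inner q p = 0 by rewrite -inner_conj pq conjC0.
have := inner_self (p + q); rewrite innerDl !innerDr pq qp addr0 add0r !inner_self.
by move=> [].
Qed.

Lemma eq_L2sq p q : (forall z, circle R z -> cabs p.[z] = cabs q.[z]) -> L2sq p = L2sq q.
Proof.
move=> pq; apply/EFin_inj; rewrite -!L2sqE; apply: ae_eq_integral => //.
- by apply/measurable_EFinP; case: (bdd_on_circle_cabs2 p).
- by apply/measurable_EFinP; case: (bdd_on_circle_cabs2 q).
- by apply: (aeS _ (ae_circle muC)) => z cz _ /=; rewrite pq.
Qed.

Lemma L2sqZ c p : L2sq (c *: p) = cabs c ^+ 2 * L2sq p.
Proof.
rewrite /L2sq -RintegralZl//; last exact: (bdd_on_circle_integrable (bdd_on_circle_cabs2 p)).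
by apply: eq_Rintegral => z _; rewrite hornerZ cabsM exprMn.
Qed.

(** Subtracting the orthogonal polynomial from a monic polynomial of the same
    degree leaves a polynomial of lower degree, orthogonal to it. *)
Lemma monic_OP_minimal Phi p n : monic_OP mu n Phi -> p \is monic -> size p = n.+1 ->
  L2sq Phi <= L2sq p.
Proof.
move=> OP pm sp; have [Phim sPhi _] := OP.
have s1 : (size (p - Phi)%R <= n)%N.
  rewrite -ltnS ltn_neqAle -{1}sp; apply/andP; split; last first.
    by rewrite (leq_trans (size_polyD _ _))// size_polyN sp sPhi maxnn.
  apply/eqP => h.
  have : (p - Phi)`_n = 0.
    rewrite coefB; move/monicP: pm; move/monicP: Phim.
    by rewrite !lead_coefE sp sPhi /= => -> ->; rewrite subrr.
  have : lead_coef (p - Phi) = 0 -> False.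
    by move/eqP; rewrite lead_coef_eq0 => /eqP h0; move: h; rewrite h0 size_poly0 sp.
  by rewrite lead_coefE h sp.
have -> : p = (p - Phi) + Phi by rewrite subrK.
by rewrite pythagoras ?(inner_orthogonal OP)// lerDr L2sq_ge0.
Qed.

Lemma cabs_revpoly p n z : (size p <= n.+1)%N -> circle R z -> cabs (revpoly n p).[z] = cabs p.[z].
Proof.
move=> sp cz; rewrite revpolyE ?circle_neq0// cabsM cabsX cz expr1n mul1r.
by rewrite cabs_conj circle_conj// invrK.
Qed.

(** The recursion writes ['X * Phi] as an orthogonal sum; on the circle
    multiplication by ['X] and the reversal preserve the modulus. *)
Lemma L2sq_verblunsky Phi Phi1 (a : C R) n : monic_OP mu n Phi -> monic_OP mu n.+1 Phi1 ->
  Phi1 = 'X * Phi - a^* *: revpoly n Phi -> L2sq Phi1 = (1 - cabs a ^+ 2) * L2sq Phi.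
Proof.
move=> [Phim sPhi _] OP1 rec.
have H : L2sq ('X * Phi) = L2sq (a^* *: revpoly n Phi + Phi1).
  by rewrite rec addrC subrK.
rewrite pythagoras in H; last first.
  by rewrite innerZl (inner_orthogonal OP1) ?mulr0// size_poly.
rewrite L2sqZ cabs_conj in H.
have e1 : L2sq ('X * Phi) = L2sq Phi.
  by apply: eq_L2sq => z cz; rewrite hornerM hornerX cabsM cz mul1r.
have e2 : L2sq (revpoly n Phi) = L2sq Phi.
  by apply: eq_L2sq => z cz; rewrite cabs_revpoly// sPhi.
rewrite e1 e2 in H; lra.
Qed.

End inner_product.

(** * Selection theorem for monotone functions *)
Section helly.
Variable R : realType.

Lemma ultra_limit (U : set_system nat) (u : nat -> R) (M : R) : UltraFilter U ->
  (forall n, `|u n| <= M) -> exists l, forall e, 0 < e -> U [set n | `|u n - l| < e].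
Proof.
move=> UU uM; have UP : ProperFilter U by exact: ultra_proper.
have [l [_ lc]] : `[-M, M] `&` cluster (u @ U) !=set0.
  apply: (@segment_compact R (-M) M).
  have h : U (u @^-1` `[-M, M]) by apply: filterE => n /=; rewrite in_itv /= -ler_norml.
  exact: h.
exists l => e e0.
have [//|Uc] := in_ultra_setVsetC [set n | `|u n - l| < e] UU.
have [x [/= xA xB]] := lc (~` [set x | `|x - l| < e]) (ball l e) Uc (nbhsx_ballx l e e0).
by case: xA; rewrite -normrN opprB.
Qed.

(** A nonprincipal ultrafilter converges at all rationals at once, and its limits
    there are turned into limits of one sequence [phi] by diagonal choice. The
    limit function [g] is the supremum of the limits at smaller rationals;
    convergence fails only at jumps, and there are countably many of these because
    each jump contains a rational. *)
Lemma helly (f : nat -> R -> R) (M : R) :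
  (forall n, {homo f n : s t / s <= t}) -> (forall n t, `|f n t| <= M) ->
  exists (phi : nat -> nat) (g : R -> R), [/\ forall k, (k <= phi k)%N,
    {homo g : s t / s <= t}, forall t, `|g t| <= M &
    exists B, countable B /\ forall t, ~ B t -> f (phi k) t @[k --> \oo] --> g t].
Proof.
move=> fi fM.
have [U [UU U_oo]] := ultraFilterLemma eventually_filter.
have /choice[l lP] : forall r : rat, exists l, forall e, 0 < e ->
    U [set n | `|f n (ratr r) - l| < e].
  by move=> r; exact: (ultra_limit UU (fun n => fM n (ratr r))).
have UP : ProperFilter U by exact: ultra_proper.
have l_homo r r' : r <= r' -> l r <= l r'.
  move=> rr'; rewrite leNgt; apply/negP => ll.
  have e0 : 0 < (l r - l r') / 2 by rewrite divr_gt0// subr_gt0.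
  have [n [/= n1 n2]] := filter_ex (filterI (lP r _ e0) (lP r' _ e0)).
  have := fi n (ratr r) (ratr r'); rewrite ler_rat => /(_ rr').
  by move: n1 n2; rewrite !ltr_norml; lra.
have lM r : `|l r| <= M.
  apply/ler_addgt0Pr => e e0; have [n /= h] := filter_ex (lP r _ e0).
  have := fM n (ratr r); move: h; rewrite ltr_norml !ler_norml; lra.
have /choice[phi phiP] : forall k : nat, exists n, (k <= n)%N /\
    forall r : rat, (pickle r <= k)%N -> `|f n (ratr r) - l r| < k.+1%:R^-1.
  move=> k; have k0 : 0 < k.+1%:R^-1 :> R by rewrite invr_gt0.
  have H m : U [set n | (k <= n)%N /\ forall r : rat, (pickle r < m)%N ->
      `|f n (ratr r) - l r| < k.+1%:R^-1].
    elim: m => [|m IH].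
      by apply: filterS (U_oo _ (nbhs_infty_ge k)) => n /= kn; split.
    case E : (unpickle m : option rat) => [r0|].
      apply: filterS2 IH (lP r0 _ k0) => n /= [kn nm] nr0; split => // r.
      rewrite ltnS leq_eqVlt => /predU1P[rm|]; last exact: nm.
      by move: E; rewrite -rm pickleK => -[->].
    apply: filterS IH => n /= [kn nm]; split => // r.
    rewrite ltnS leq_eqVlt => /predU1P[rm|]; last exact: nm.
    by move: E; rewrite -rm pickleK.
  by have [n [kn nm]] := filter_ex (H k.+1); exists n; split=> // r rk; apply: nm.
have cvg_l r : f (phi k) (ratr r) @[k --> \oo] --> l r.
  apply/cvgrPdist_lt => e e0.
  near=> k; rewrite distrC.
  have rk : (pickle r <= k)%N by near: k; exact: nbhs_infty_ge.
  apply: (lt_le_trans ((phiP k).2 r rk)); apply: ltW.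
  by near: k; exact: near_infty_natSinv_lt (PosNum e0).
pose L (t : R) := [set l r | r in [set r : rat | ratr r < t]].
pose g (t : R) := sup (L t).
have L_sup t : has_sup (L t).
  split.
    have [r] := @rat_in_itvoo _ (t - 1) t ltac:(lra).
    by rewrite in_itv /= => /andP[_ rt]; exists (l r); exists r.
  by exists M => _ [r _ <-]; apply: le_trans (lM r); exact: ler_norm.
have g_ge r t : ratr r < t -> l r <= g t.
  by move=> rt; apply: ub_le_sup; [exact: (L_sup t).2|exists r].
have g_le r t : t <= ratr r -> g t <= l r.
  move=> tr; apply: ge_sup; first exact: (L_sup t).1.
  by move=> _ [r' /= r't <-]; apply: l_homo; rewrite -(ler_rat R); apply: le_trans tr; exact: ltW.
have rat_btw (s t : R) : s < t -> exists r : rat, s < ratr r < t.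
  by move=> st; have [r] := rat_in_itvoo st; rewrite in_itv; exists r.
have g_homo (s t : R) : s <= t -> g s <= g t.
  rewrite (le_eqVlt s) => /orP[/eqP ->//|st]; have [r /andP[sr rt]] := rat_btw _ _ st.
  by apply: (le_trans (g_le r _ (ltW sr))); exact: g_ge.
exists phi, g; split.
- by move=> k; case: (phiP k).
- exact: g_homo.
- move=> t; rewrite ler_norml; apply/andP; split.
    have [r /andP[_ rt]] := rat_btw (t - 1) t ltac:(lra).
    by apply: (le_trans _ (g_ge r _ rt)); have := lM r; rewrite ler_norml => /andP[].
  have [r /andP[tr _]] := rat_btw t (t + 1) ltac:(lra).
  by apply: (le_trans (g_le r _ (ltW tr))); have := lM r; rewrite ler_norml => /andP[].
pose B := [set t : R | exists r : rat, g t < ratr r /\ forall r' : rat, t < ratr r' -> ratr r < l r'].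
exists B; split.
- have /choice[c cP] : forall t : R, exists r : rat, B t ->
     g t < ratr r /\ forall r' : rat, t < ratr r' -> ratr r < l r'.
    move=> t; have [[r rP]|nB] := pselect (B t); first by exists r.
    by exists 0.
  apply/countable_injP; exists (pickle \o c) => s t; rewrite !inE => Bs Bt /=.
  move/(pcan_inj pickleK) => cst.
  have [s1 s2] := cP _ Bs; have [t1 t2] := cP _ Bt.
  have H (a b : R) : a < b -> g b < ratr (c b) -> (forall r' : rat, a < ratr r' -> ratr (c a) < l r') ->
      c a = c b -> False.
    move=> /rat_btw[r /andP[ar rb]] h1 h2 cab.
    by have := h2 _ ar; have := g_ge _ _ rb; rewrite cab; lra.
  have [st|ts|//] := ltgtP s t; exfalso; first exact: (H s t).
  exact: (H t s).
- move=> t nB; apply/cvgrPdist_lt => e e0.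
  have [_ [r1 r1t <-] hr1] : exists2 x, L t x & g t - e / 2 < x.
    by apply: sup_adherent; [rewrite divr_gt0|exact: L_sup].
  have [r2 r2t hr2] : exists2 r2 : rat, t < ratr r2 & l r2 < g t + e / 2.
    apply: contrapT => h; apply: nB.
    have [r /andP[rl rr]] := rat_btw (g t) (g t + e / 2) ltac:(lra).
    exists r; split => // r' tr'; apply: lt_le_trans rr _.
    by rewrite leNgt; apply/negP => h'; apply: h; exists r'.
  have h1 : \forall k \near \oo, `|f (phi k) (ratr r1) - l r1| < e / 2.
    have e20 : 0 < e / 2 by rewrite divr_gt0.
    have /cvgrPdist_lt/(_ _ e20) := cvg_l r1.
    by apply: filterS => k; rewrite distrC.
  have h2 : \forall k \near \oo, `|f (phi k) (ratr r2) - l r2| < e / 2.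
    have e20 : 0 < e / 2 by rewrite divr_gt0.
    have /cvgrPdist_lt/(_ _ e20) := cvg_l r2.
    by apply: filterS => k; rewrite distrC.
  apply: filterS2 h1 h2 => k; rewrite !ltr_norml.
  have := fi (phi k) _ _ (ltW r1t); have := fi (phi k) _ _ (ltW r2t).
  by move: hr1 hr2; lra.
Unshelve. all: by end_near.
Qed.

End helly.

(** * Step functions on the unit interval *)
Section unit_interval.
Variable R : realType.

Definition unif : set (measurableTypeR R) -> \bar R :=
  mrestr lebesgue_measure (measurable_itv `[0%R, 1%R[).

HB.instance Definition _ := Measure.on unif.

Let unif_setT : unif setT = 1%E.
Proof. by rewrite /unif /mrestr setTI lebesgue_measure_itv /= lte01 oppr0 adde0. Qed.

HB.instance Definition _ := Measure_isProbability.Build _ _ _ unif unif_setT.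

Lemma integral_unif (f : R -> \bar R) : measurable_fun setT f -> (forall t, 0 <= f t)%E ->
  (\int[unif]_t f t = \int[lebesgue_measure]_(t in `[0%R, 1%R[) f t)%E.
Proof. by move=> mf f0; rewrite -(ge0_integral_mrestr lebesgue_measure _ mf f0). Qed.

Lemma unif_countable (B : set R) : countable B -> unif B = 0%E.
Proof.
move=> cB; have mB : measurable B by exact: countable_measurable.
apply/eqP; rewrite -measure_le0 /= /unif /mrestr -(countable_lebesgue_measure0 cB).
by rewrite le_measure ?inE//; exact: measurableI.
Qed.

Lemma ae_unif_itv : {ae unif, forall t, 0 <= t < 1}.
Proof.
exists (~` `[0%R, 1%R[); split.
- by apply: measurableC; exact: measurable_itv.
- by rewrite /= /unif /mrestr setICl measure0.
- by move=> t /= h; rewrite in_itv.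
Qed.

Lemma measurable_truncn (c : R) (H : nat -> \bar R) : 0 <= c ->
  measurable_fun setT (fun t : R => H (Num.truncn (c * t))).
Proof.
move=> c0; have mt : measurable_fun setT (fun t : R => (Num.truncn (c * t))%:R : R).
  apply: measurable_realfun.nondecreasing_measurable => // s t st.
  by rewrite ler_nat le_truncn// ler_wpM2l.
move=> _ B mB; rewrite setTI.
have -> : (fun t : R => H (Num.truncn (c * t))) @^-1` B =
   (fun t : R => (Num.truncn (c * t))%:R : R) @^-1` [set (n%:R : R) | n in H @^-1` B].
  apply/seteqP; split => t /=; first by exists (Num.truncn (c * t)).
  by move=> [n Hn /eqP]; rewrite eqr_nat => /eqP <-.
rewrite -[X in measurable X]setTI; apply: mt => //.
have : countable [set (n%:R : R) | n in H @^-1` B].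
  exact: sub_countable (card_image_le _ _) (countableP _).
exact: countable_measurable.
Qed.

Lemma integral_step (N : nat) (H : nat -> \bar R) : (forall i, 0 <= H i)%E ->
  (\int[unif]_t H (Num.truncn (N.+1%:R * t)) = N.+1%:R^-1%:E * \sum_(i < N.+1) H i)%E.
Proof.
move=> H0; set c : R := N.+1%:R; have c0 : 0 < c by rewrite ltr0n.
have mH := measurable_truncn H (ltW c0).
rewrite integral_unif//.
have step m : (\int[lebesgue_measure]_(t in `[0%R, (m%:R / c)%R[) H (Num.truncn (c * t)) =
   c^-1%:E * \sum_(i < m) H i)%E.
  elim: m => [|m IH].
    by rewrite mul0r set_itvco0 integral_set0 big_ord0 mule0.
  have h1 : 0 <= m%:R / c by rewrite divr_ge0// ltW.
  have h2 : m%:R / c <= m.+1%:R / c by rewrite ler_pM2r ?invr_gt0// ler_nat.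
  have -> : `[0, (m.+1%:R / c)[%classic = `[0, (m%:R / c)[ `|` `[(m%:R / c), (m.+1%:R / c)[.
    by rewrite -itv_bndbnd_setU// bnd_simp.
  rewrite ge0_integral_setU//; last 2 first.
  - exact: measurable_funTS.
  - apply/disj_setPS => t [] /=; rewrite !in_itv /= => /andP[_ a1] /andP[a2 _].
    by move: (lt_le_trans a1 a2); rewrite ltxx.
  rewrite IH big_ord_recr /= ge0_muleDr//; last by apply: sume_ge0.
  congr (_ + _)%E.
  rewrite (_ : (\int[lebesgue_measure]_(t in `[(m%:R / c)%R, (m.+1%:R / c)%R[) H (Num.truncn (c * t)) =
     \int[lebesgue_measure]_(t in `[(m%:R / c)%R, (m.+1%:R / c)%R[) (cst (H m) t))%E); last first.
    apply: eq_integral => t; rewrite inE /= in_itv /= => /andP[a1 a2].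
    congr H; apply: truncn_def; rewrite mulrC.
    by rewrite -ler_pdivrMr// -ltr_pdivlMr// a1.
  rewrite integral_cst//= lebesgue_measure_itv /= lte_fin ltr_pM2r ?invr_gt0// ltr_nat ltnSn.
  rewrite -EFinB muleC; congr (_%:E * _)%E.
  by rewrite -mulrBl -natrB// subSnn mul1r.
by have := step N.+1; rewrite divff// gt_eqF.
Qed.

End unit_interval.

(** * Parametrisation of the circle by the angle *)
Section angle.
Variable R : realType.
Implicit Types t s : R.

Definition cis t : C R := Complex (cos t) (sin t).

Lemma ler_cabs_ReIm (z : C R) : cabs z <= `|complex.Re z| + `|complex.Im z|.
Proof.
case: z => x y; rewrite -(@ler_pXn2r _ 2)// ?nnegrE ?cabs_ge0 ?addr_ge0//.
rewrite cabs_sqr /= sqrrD !real_normK ?num_real//.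
have : 0 <= `|x| * `|y| by rewrite mulr_ge0.
lra.
Qed.

Lemma angle_surj (z : C R) : circle R z -> exists t, `|t| <= pi /\ cis t = z.
Proof.
move=> cz; have := cabs_sqr z; rewrite cz expr1n; case: z cz => x y /= _ xy.
have x1 : -1 <= x <= 1.
  have : x ^+ 2 <= 1 by rewrite xy lerDl sqr_ge0.
  by rewrite -ler_norml -real_normK ?num_real// expr_le1.
have cx : cos (acos x) = x by rewrite acosK// in_itv.
have sx : sin (acos x) = `|y|.
  by rewrite sin_acos// xy addrAC subrr add0r sqrtr_sqr.
have p0 : 0 <= acos x by exact: acos_ge0.
have p1 : acos x <= pi by exact: acos_lepi.
have [y0|y0] := leP 0 y.
  exists (acos x); split; first by rewrite ger0_norm.
  by rewrite /cis cx sx ger0_norm.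
exists (- acos x); split; first by rewrite normrN ger0_norm.
by rewrite /cis cosN sinN cx sx ltr0_norm// opprK.
Qed.

Lemma cis_cvg (u : nat -> R) t : u @ \oo --> t ->
  (fun n => cabs (cis (u n) - cis t)) @ \oo --> (0 : R).
Proof.
move=> ut; apply: (@squeeze_cvgr _ _ _ _ (fun=> 0)
  (fun n => `|cos (u n) - cos t| + `|sin (u n) - sin t|)).
- apply: nearW => n; apply/andP; split; first exact: cabs_ge0.
  exact: ler_cabs_ReIm.
- exact: cvg_cst.
- have h (w : R -> R) : continuous w -> (fun n => `|w (u n) - w t|) @ \oo --> (0 : R).
    move=> cw; rewrite -(normr0 R); apply: cvg_norm.
    by rewrite -(subrr (w t)); apply: cvgB; [exact: (continuous_cvg _ (cw t))|exact: cvg_cst].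
  by rewrite -(addr0 (0 : R)); apply: cvgD; apply: h; [exact: continuous_cos|exact: continuous_sin].
Qed.

Lemma cis_dist_cvg (u v : nat -> R) t s : u @ \oo --> t -> v @ \oo --> s ->
  (fun n => cabs (cis (u n) - cis (v n))) @ \oo --> cabs (cis t - cis s).
Proof.
move=> ut vs; apply/subr_cvg0; apply: (@squeeze_cvgr _ _ _ _
  (fun n => - (cabs (cis (u n) - cis t) + cabs (cis (v n) - cis s)))
  (fun n => cabs (cis (u n) - cis t) + cabs (cis (v n) - cis s))).
- apply: nearW => n; rewrite -ler_norml; apply: (le_trans (ler_cabs_dist _ _)).
  rewrite [X in _ <= _ + X]cabsC.
  have -> : cis (u n) - cis (v n) - (cis t - cis s) = (cis (u n) - cis t) + (cis s - cis (v n)).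
    by ring.
  exact: ler_cabsD.
- by rewrite -oppr0; apply: cvgN; rewrite -(addr0 (0 : R)); apply: cvgD; exact: cis_cvg.
- by rewrite -(addr0 (0 : R)); apply: cvgD; exact: cis_cvg.
Qed.

Lemma measurable_cis : measurable_fun setT (cis : measurableTypeR R -> borelC R).
Proof.
apply: (@measurability _ _ _ (borelC R) setT _ (@open (C R)) erefl).
move=> _ [U oU <-]; rewrite setTI; apply: open_measurable.
rewrite openE => t /= Ut; have [r r0 rU] := (openCP U).1 oU _ Ut.
have r20 : 0 < r / 2 by rewrite divr_gt0.
have /cvgrPdist_lt/(_ _ r20) h1 := @continuous_cos R t.
have /cvgrPdist_lt/(_ _ r20) h2 := @continuous_sin R t.
apply: filterS2 h1 h2 => s hs1 hs2; apply: rU.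
by apply: le_lt_trans (ler_cabs_ReIm _) _ => /=; lra.
Qed.

End angle.

(** * Limits of discrete measures of bounded energy *)
Section limit_measure.
Variables (R : realType) (K : set (C R)) (z : nat -> C R) (W : R).
Hypothesis Kclosed : closed K.
Hypothesis Kz : forall i, K (z i).
Hypothesis z_inj : injective z.
Hypothesis z_energy : forall n,
  (\sum_(i < n.+1) \sum_(j < n.+1 | j != i) kap (cabs (z i - z j)) <=
   (n.+1%:R ^+ 2 * W)%:E)%E.

(** A discrete measure has infinite energy; dropping the diagonal leaves a kernel
    whose double integral is the discrete energy. *)
Let offdiag (x y : R) : \bar R := if x == y then 0%E else kap (cabs (cis x - cis y)).

Let offdiag_ge0 x y : (0 <= offdiag x y)%E.
Proof. by rewrite /offdiag; case: eqP => // _; exact: kap_ge0. Qed.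

Variable a : nat -> R.
Hypothesis a_pi : forall i, `|a i| <= pi.
Hypothesis cis_a : forall i, cis (a i) = z i.

Let a_inj : injective a.
Proof. by move=> i j /(congr1 (@cis R)); rewrite !cis_a; exact: z_inj. Qed.

Let u n := sort <=%R [seq a i | i <- iota 0 n.+1].

Let size_u n : size (u n) = n.+1.
Proof. by rewrite size_sort size_map size_iota. Qed.

Let mem_u n x : x \in u n -> exists i, x = a i.
Proof. by rewrite mem_sort => /mapP[i _ ->]; exists i. Qed.

(** The quantile function of the empirical measure of the first [n.+1] angles. The
    default value [pi], reached for [1 <= t], keeps it nondecreasing and bounded on
    the whole line. *)
Let quant n (t : R) := nth pi (u n) (Num.truncn (n.+1%:R * t)).

Let nth_u_pi n i : `|nth pi (u n) i| <= pi.
Proof.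
have [h|h] := ltnP i (size (u n)); last by rewrite nth_default// ger0_norm// pi_ge0.
by have /mem_u[j ->] := mem_nth pi h.
Qed.

Let quant_homo n : {homo quant n : s t / s <= t}.
Proof.
move=> s t st; rewrite /quant.
have ij : (Num.truncn (n.+1%:R * s) <= Num.truncn (n.+1%:R * t))%N.
  by rewrite le_truncn// ler_wpM2l.
set i := Num.truncn _ in ij *; set j := Num.truncn _ in ij *.
have [h|h] := ltnP j (size (u n)).
  apply: (sorted_leq_nth le_trans lexx) => //; last by rewrite inE (leq_ltn_trans ij).
  by apply: sort_sorted; exact: le_total.
rewrite [leRHS]nth_default//; apply: le_trans (nth_u_pi n i); exact: ler_norm.
Qed.

Let sum_offdiag n :
  (\sum_(i < n.+1) \sum_(j < n.+1) offdiag (nth pi (u n) i) (nth pi (u n) j) <=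
   (n.+1%:R ^+ 2 * W)%:E)%E.
Proof.
have pu := permEl (perm_sort <=%R [seq a i | i <- iota 0 n.+1]).
have -> : (\sum_(i < n.+1) \sum_(j < n.+1) offdiag (nth pi (u n) i) (nth pi (u n) j) =
    \sum_(x <- u n) \sum_(y <- u n) offdiag x y)%E.
  rewrite [RHS](big_nth pi) size_u big_mkord; apply: eq_bigr => i _.
  by rewrite [RHS](big_nth pi) size_u big_mkord.
have -> : (\sum_(x <- u n) \sum_(y <- u n) offdiag x y =
    \sum_(i < n.+1) \sum_(j < n.+1) offdiag (a i) (a j))%E.
  rewrite (perm_big _ pu) big_map -[iota 0 n.+1]/(index_iota 0 n.+1) big_mkord.
  by apply: eq_bigr => i _; rewrite (perm_big _ pu) big_map -[iota 0 n.+1]/(index_iota 0 n.+1) big_mkord.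
apply: le_trans (z_energy n); apply: lee_sum => i _.
rewrite [leRHS]big_mkcond /=; apply: lee_sum => j _; rewrite /offdiag !cis_a.
have [->|ij] := eqVneq j i; first by rewrite !eqxx.
by case: ifP => // _; exact: kap_ge0.
Qed.

(** Parameters at distance at least [1 / n.+1] lie on different steps, and the angles
    are distinct: away from the diagonal [offdiag] agrees in the limit with the
    kernel. *)
Let quant_lt n (s t : R) : 0 <= s -> t < 1 -> 1 <= n.+1%:R * (t - s) ->
  quant n s != quant n t.
Proof.
move=> s0 t1 st; have n0 : 0 < n.+1%:R :> R by rewrite ltr0n.
have t0 : s <= t.
  by rewrite -subr_ge0 -(pmulr_rge0 _ n0) (le_trans _ st).
have ij : (Num.truncn (n.+1%:R * s) < Num.truncn (n.+1%:R * t))%N.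
  rewrite truncn_ge_nat; last by rewrite mulr_ge0// (le_trans s0).
  have : (Num.truncn (n.+1%:R * s))%:R <= n.+1%:R * s by rewrite truncn_le mulr_ge0.
  by move: st; rewrite mulrBr -[(Num.truncn (n.+1%:R * s)).+1%:R]natr1; lra.
have tN : (Num.truncn (n.+1%:R * t) < n.+1)%N.
  by rewrite truncn_lt_nat ?gtr_pMr// mulr_ge0// (le_trans s0).
rewrite /quant nth_uniq ?size_u//.
- by rewrite neq_ltn ij.
- exact: ltn_trans tN.
- by rewrite sort_uniq map_inj_uniq ?iota_uniq.
Qed.

Let hstep n (s t : R) := offdiag (quant n s) (quant n t).

Let hstep_int n s : (\int[@unif R]_t hstep n s t =
  n.+1%:R^-1%:E * \sum_(j < n.+1) offdiag (quant n s) (nth pi (u n) j))%E.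
Proof.
by rewrite -(integral_step n (H := fun j => offdiag (quant n s) (nth pi (u n) j))).
Qed.

Let hstep_int2 n : (\int[@unif R]_s \int[@unif R]_t hstep n s t <= W%:E)%E.
Proof.
have n0 : (0 <= (n.+1%:R^-1)%:E :> \bar R)%E by rewrite lee_fin.
under eq_integral do rewrite hstep_int.
rewrite (integral_step n (H := fun i => (n.+1%:R^-1%:E *
  \sum_(j < n.+1) offdiag (nth pi (u n) i) (nth pi (u n) j))%E)); last first.
  by move=> i; rewrite mule_ge0// sume_ge0.
rewrite -ge0_sume_distrr; last by move=> i _; apply: sume_ge0.
rewrite muleA -EFinM; apply: le_trans (lee_wpmul2l _ (sum_offdiag n)) _.
  by rewrite lee_fin.
by rewrite -EFinM lee_fin mulrA expr2 -invfM mulVf ?mul1r// mulf_neq0.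
Qed.

(** The limit measure is the law of [cis \o g] under the uniform distribution, for
    a Helly limit [g] of the quantile functions. Since these converge almost
    everywhere, Fatou's lemma, applied in each variable, passes the bound for the
    discrete energies to the limit. *)
Lemma limit_measure_of_angles : exists nu : probability (borelC R) R,
  nu (~` K) = 0%E /\ (\int[nu]_x pot nu x <= W%:E)%E.
Proof.
have [phi [g [phik g_homo gM [B [cB gB]]]]] :=
  helly quant_homo (fun n t => nth_u_pi n (Num.truncn (n.+1%:R * t))).
have mg : measurable_fun setT (g : measurableTypeR R -> measurableTypeR R).
  exact: measurable_realfun.nondecreasing_measurable.
have mX : measurable_fun setT ((@cis R \o g) : measurableTypeR R -> borelC R).
  by apply: measurableT_comp => //; exact: measurable_cis.
pose nu : probability (borelC R) R := distribution (@unif R) (mfun_Sub (mem_set mX)).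
have nu_int (F : borelC R -> \bar R) : measurable_fun setT F -> (forall x, 0 <= F x)%E ->
    (\int[nu]_x F x = \int[@unif R]_t F (cis (g t)))%E.
  by move=> mF F0; rewrite (ge0_integral_pushforward mX).
have good : {ae @unif R, forall t, 0 <= t < 1 /\ ~ B t}.
  apply: (aeS2 _ (ae_unif_itv R)) => [t h1 h2|]; first by split; [exact: h1|exact: h2].
  exists B; split; first exact: countable_measurable.
    exact: unif_countable.
  by move=> t /= /contrapT.
exists nu; split.
- have mK : measurable (~` K : set (borelC R)).
    by apply: measurableC; exact: measurable_closed.
  have mXK : measurable ((@cis R \o g) @^-1` (~` K) : set (measurableTypeR R)).
    by rewrite -[X in measurable X]setTI; apply: (mX measurableT _ mK).
  suff aeK : {ae @unif R, forall t, K (cis (g t))} by exact: (measure_negligible mXK aeK).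
  apply: (aeS _ good) => t [t01 nBt]; apply: contrapT => nK.
  have [r r0 rK] := (openCP (~` K)).1 (closed_openC Kclosed) _ nK.
  have := cis_cvg (gB _ nBt) => /cvgrPdist_lt/(_ _ r0) H.
  have [k] := filter_ex H; rewrite sub0r normrN ger0_norm ?cabs_ge0// cabsC => /rK; apply.
  rewrite /quant.
  have h : (Num.truncn ((phi k).+1%:R * t) < size (u (phi k)))%N.
    rewrite size_u truncn_lt_nat.
      by case/andP: t01 => _ t1; rewrite gtr_pMr.
    by case/andP: t01 => t0 _; rewrite mulr_ge0.
  by have /mem_u[i ->] := mem_nth pi h; rewrite cis_a.
rewrite nu_int; [|exact: measurable_pot|exact: pot_ge0].
have potE s : pot nu (cis (g s)) = (\int[@unif R]_t kap (cabs (cis (g s) - cis (g t))))%E.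
  by rewrite /pot nu_int//; [exact: measurable_kap_l|move=> w; exact: kap_ge0].
have mh n s : measurable_fun setT (hstep n s : measurableTypeR R -> \bar R).
  exact: (measurable_truncn (fun j => offdiag (quant n s) (nth pi (u n) j))).
apply: (@le_trans _ _ (limn_einf (fun k => \int[@unif R]_s \int[@unif R]_t hstep (phi k) s t)%E)).
  apply: (@fatou_einf _ _ _ (@unif R) (fun k s => \int[@unif R]_t hstep (phi k) s t)%E).
  - move=> k; under eq_fun do rewrite hstep_int.
    exact: (measurable_truncn (fun i => ((phi k).+1%:R^-1%:E *
      \sum_(j < (phi k).+1) offdiag (nth pi (u (phi k)) i) (nth pi (u (phi k)) j))%E)).
  - apply: (measurableT_comp (f := pot nu : borelC R -> \bar R)) => //.
    exact: measurable_pot.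
  - by move=> n x; apply: integral_ge0 => t _; exact: offdiag_ge0.
  - by move=> x; exact: pot_ge0.
  apply: (aeS _ good) => s [s01 nBs]; rewrite potE.
  apply: (@fatou_einf _ _ _ (@unif R) (fun k t => hstep (phi k) s t)).
  - by move=> k; exact: mh.
  - apply: (measurableT_comp (f := (fun w => kap (cabs (cis (g s) - w))) : borelC R -> \bar R)) => //.
    exact: measurable_kap_l.
  - by move=> n x; exact: offdiag_ge0.
  - by move=> x; exact: kap_ge0.
  have ne_s : {ae @unif R, forall t, t != s}.
    exists [set s]; split; first exact: measurable_set1.
      exact: unif_countable (countable1 s).
    by move=> t /= /negP; rewrite negbK => /eqP.
  apply: (aeS2 _ good ne_s) => t [t01 nBt] ts.
  have H : (fun k => kap (cabs (cis (quant (phi k) s) - cis (quant (phi k) t)))) @ \oo -->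
      kap (cabs (cis (g s) - cis (g t))).
    by apply: (kap_cvg (u := fun k => cabs _)); apply: cis_dist_cvg; exact: gB.
  suff /cvg_limn_einf_sup[-> _] : (fun k => hstep (phi k) s t) @ \oo -->
      kap (cabs (cis (g s) - cis (g t))) by [].
  apply: cvg_trans H; apply: near_eq_cvg.
  have d0 : 0 < `|t - s| by rewrite normr_gt0 subr_eq0.
  have : \forall k \near \oo, (Num.truncn (`|t - s|^-1)%R <= k)%N by exact: nbhs_infty_ge.
  apply: filterS => k hk; rewrite /hstep /offdiag /=.
  have hd : 1 <= (phi k).+1%:R * `|t - s|.
    rewrite -ler_pdivrMr// mul1r (le_trans (ltW (truncnS_gt _)))// ler_nat ltnS.
    exact: leq_trans hk (phik k).
  suff -> : (quant (phi k) s == quant (phi k) t) = false by [].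
  apply/negbTE; move: hd; case/andP: s01 => s0 s1; case/andP: t01 => t0 t1.
  have [st|st|tse] := ltgtP s t; last by rewrite tse eqxx in ts.
    by rewrite gtr0_norm ?subr_gt0// => h; exact: quant_lt.
  by rewrite ltr0_norm ?subr_lt0// opprB eq_sym => h; exact: quant_lt.
apply: limn_einf_le => k; exact: hstep_int2.
Qed.

End limit_measure.

(** * Greedy points *)
Section leja_points.
Variables (R : realType) (K : set (C R)) (v : R).
Hypothesis Kclosed : closed K.
Hypothesis Kcircle : K `<=` circle R.
Hypothesis Kbig : forall (p : {poly C R}) m, p \is monic -> size p = m.+1 ->
  exists2 z, K z & expR (- (m%:R * v)) <= cabs p.[z].

Let iota_index k : iota 0 k = index_iota 0 k.
Proof. by rewrite /index_iota subn0. Qed.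

(** Leja's greedy choice: each point is taken where the monic polynomial that
    vanishes at its predecessors is large on [K]. *)
Lemma leja_sequence : exists z : nat -> C R, (forall k, K (z k)) /\
  forall k, expR (- (k%:R * v)) <= \prod_(i < k) cabs (z i - z k).
Proof.
pose P (s : seq (C R)) := \prod_(x <- s) ('X - x%:P).
have /choice[sel selP] : forall s : seq (C R), exists z, K z /\
    expR (- ((size s)%:R * v)) <= cabs (P s).[z].
  move=> s; have [||z Kz hz] := @Kbig (P s) (size s).
  - exact: monic_prod_XsubC.
  - exact: size_prod_XsubC.
  by exists z.
pose s := fix s k := if k is k'.+1 then rcons (s k') (sel (s k')) else [::].
pose z k := sel (s k).
have sE k : s k = [seq z i | i <- iota 0 k].
  elim: k => [//|k IH].
  by rewrite -(addn1 k) iotaD map_cat addn1 /= -IH cats1.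
exists z; split=> k; first by case: (selP (s k)).
case: (selP (s k)) => _; rewrite -/(z k) {1}sE size_map size_iota => /le_trans; apply.
rewrite /P horner_prod cabs_prod sE big_map iota_index big_mkord.
by rewrite le_eqVlt; apply/orP; left; apply/eqP/eq_bigr => i _; rewrite hornerXsubC cabsC.
Qed.

(** In the discrete energy of the first [n] greedy points each point contributes,
    together with its predecessors, minus twice the logarithm of one of the
    products bounded in [leja_sequence]. *)
Lemma leja_limit_measure : exists nu : probability (borelC R) R,
  nu (~` K) = 0%E /\ (\int[nu]_x pot nu x <= (ln 2 + v)%:E)%E.
Proof.
have [z [Kz hz]] := leja_sequence.
have prod_gt0 k : 0 < \prod_(i < k) cabs (z i - z k).
  by apply: lt_le_trans (hz k); exact: expR_gt0.
have dist_gt0 i k : (i < k)%N -> 0 < cabs (z i - z k).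
  move=> ik; rewrite lt_def cabs_ge0 andbT; apply/eqP => h.
  by have := prod_gt0 k; rewrite (bigD1 (Ordinal ik))//= h mul0r ltxx.
have z_inj : injective z.
  move=> i j zij; have [ij|ji|//] := ltngtP i j; exfalso.
    by have := dist_gt0 _ _ ij; rewrite zij subrr cabs0 ltxx.
  by have := dist_gt0 _ _ ji; rewrite zij subrr cabs0 ltxx.
have rowE k : (\sum_(i < k) kap (cabs (z i - z k)) <= (k%:R * (ln 2 + v))%:E)%E.
  have := @sum_kapE R [seq z i | i <- iota 0 k] (z k).
  rewrite !big_map iota_index !big_mkord => ->; last first.
    by move=> _ /mapP[i _ ->]; apply: circle_dist_le2; exact: Kcircle.
  rewrite prod_gt0 lee_fin size_map size_iota subn0 mulrDr lerD2l lerNl.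
  by rewrite -[leLHS]expRK ler_ln ?posrE ?expR_gt0// hz.
pose W := ln 2 + v.
have W0 : 0 <= W.
  rewrite -lee_fin; apply: le_trans (_ : (\sum_(i < 1) kap (cabs (z i - z 1%N)) <= _)%E).
    by apply: sume_ge0 => i _; exact: kap_ge0.
  by have := rowE 1%N; rewrite mul1r.
pose e (i j : nat) := if i == j then 0%E else kap (cabs (z i - z j)).
have e_sym i j : e i j = e j i by rewrite /e eq_sym cabsC.
have e_lt i k : (i < k)%N -> e i k = kap (cabs (z i - z k)).
  by rewrite /e => /ltn_eqF ->.
have dbl n : (\sum_(i < n) \sum_(j < n) e i j <= (n%:R ^+ 2 * W)%:E)%E.
  elim: n => [|n IH]; first by rewrite big_ord0 expr0n mul0r.
  rewrite big_ord_recr /=.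
  under eq_bigr do rewrite big_ord_recr /=.
  have enn : e n n = 0%E by rewrite /e eqxx.
  rewrite big_split /= big_ord_recr /= enn adde0.
  have e1 : (\sum_(i < n) e i n <= (n%:R * W)%:E)%E.
    by apply: le_trans (rowE n); apply: lee_sum => i _; rewrite e_lt.
  have e2 : (\sum_(i < n) e n i <= (n%:R * W)%:E)%E.
    by under eq_bigr do rewrite e_sym.
  apply: (le_trans (leeD (leeD IH e1) e2)).
  rewrite -!EFinD lee_fin -[n.+1%:R]natr1 sqrrD expr1n mulr1 !mulrDl mul1r.
  lra.
have /choice[a aP] : forall i, exists t, `|t| <= pi /\ cis t = z i.
  by move=> i; apply: angle_surj; exact: Kcircle.
apply: (@limit_measure_of_angles R K z W Kclosed Kz z_inj _ a).
- move=> n; apply: le_trans (dbl n.+1); apply: lee_sum => i _.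
  rewrite big_mkcond /=; apply: lee_sum => j _; rewrite /e.
  have [->|ij] := eqVneq j i; first by rewrite eqxx.
  by rewrite (_ : (i == j :> nat) = false)//; apply/negbTE; rewrite eq_sym.
- by move=> i; case: (aP i).
- by move=> i; case: (aP i).
Qed.

End leja_points.

(** * Support and essential spectrum *)
Section support.
Variable R : realType.
Implicit Types z w : C R.

Lemma measurable_point z : measurable ([set z] : set (borelC R)).
Proof.
apply: measurable_closed; rewrite -(setCK [set z]); apply: open_closedC.
apply/openCP => w wz; exists (cabs (w - z)).
  by rewrite cabs_gt0 subr_eq0; apply/eqP.
by move=> x wx xz; move: wx; rewrite xz ltxx.
Qed.

(** An atom makes the potential infinite at its own position. *)
Lemma finite_energy_atomless (nu : probability (borelC R) R) z :
  (\int[nu]_x pot nu x < +oo)%E -> nu [set z] = 0%E.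
Proof.
move=> fin; apply: contrapT => /eqP nz.
have nz0 : (0 < nu [set z])%E by rewrite lt0e nz measure_ge0.
have mz := measurable_point z.
have potz : pot nu z = +oo%E.
  apply/eqP; rewrite -leye_eq.
  apply: (@le_trans _ _ (\int[nu]_(w in [set z]) kap (cabs (z - w)))%E); last first.
    by apply: ge0_subset_integral => //; [exact: measurable_kap_l|move=> w _; exact: kap_ge0].
  rewrite (_ : (\int[nu]_(w in [set z]) _ = \int[nu]_(w in [set z]) (cst +oo w))%E); last first.
    by apply: eq_integral => w; rewrite inE /= => ->; rewrite subrr cabs0 /kap lexx.
  by rewrite integral_cst// gt0_mulye.
move: fin; rewrite ltNge; apply/negP; rewrite negbK.
apply: (@le_trans _ _ (\int[nu]_(x in [set z]) pot nu x)%E); last first.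
  by apply: ge0_subset_integral => //; [exact: measurable_pot|move=> x _; exact: pot_ge0].
rewrite (_ : (\int[nu]_(w in [set z]) _ = \int[nu]_(w in [set z]) (cst +oo w))%E); last first.
  by apply: eq_integral => w; rewrite inE /= => ->; rewrite potz.
by rewrite integral_cst// gt0_mulye.
Qed.

Variable mu : {measure set (borelC R) -> \bar R}.

Lemma not_supp z : ~ supp mu z -> exists2 U : set (C R), open_nbhs z U & mu U = 0%E.
Proof.
move=> /existsNP[U /not_implyP[zU /negP]]; rewrite -leNgt => mU.
by exists U => //; apply/eqP; rewrite -measure_le0.
Qed.

Lemma closed_supp : closed (supp mu).
Proof.
rewrite -(setCK (supp mu)); apply: open_closedC; apply/openCP => z /not_supp[U [oU zU] mU].
have [r r0 rU] := (openCP U).1 oU _ zU; exists r => // w /rU wU hw.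
by have := hw U (conj oU wU); rewrite mU ltxx.
Qed.

Lemma measure_supp : mu (~` supp mu) = 0%E.
Proof.
apply: null_of_locally_null; last exact: not_supp.
by apply: measurableC; apply: measurable_closed; exact: closed_supp.
Qed.

Lemma supp_circle : mu (~` circle R) = 0%E -> supp mu `<=` circle R.
Proof.
move=> h z hz; apply: contrapT => cz.
have oC : open (~` circle R) by apply: closed_openC; exact: closed_circle.
by have := hz _ (conj oC cz); rewrite h ltxx.
Qed.

(** Outside the essential spectrum the support consists of isolated points, which
    are invisible to a measure of finite energy. *)
Lemma finite_energy_ess_spectrum (nu : probability (borelC R) R) :
  closed (ess_spectrum mu) -> nu (~` supp mu) = 0%E ->
  (\int[nu]_x pot nu x < +oo)%E -> nu (~` ess_spectrum mu) = 0%E.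
Proof.
move=> cE nuS fin; apply: null_of_locally_null.
  by apply: measurableC; exact: measurable_closed.
have oS : open (~` supp mu) by apply: closed_openC; exact: closed_supp.
have mS : measurable (~` supp mu : set (borelC R)) by exact: measurable_open.
move=> z zE; have [zS|zS] := pselect (supp mu z); last by exists (~` supp mu).
have [_ [V zV VS]] : isolated (supp mu) z.
  by apply: contrapT => h; apply: zE; split.
move: zV; rewrite nbhsE => -[U [oU zU] UV]; exists U => //.
have mz := measurable_point z.
have : (nu U <= nu (~` supp mu) + nu [set z])%E.
  apply: le_trans (measureU2 _ _ _) => //.
  apply: le_measure; rewrite ?inE//; [exact: measurable_open|exact: measurableU|].
  move=> w Uw; have [wS|] := pselect (supp mu w); last by left.
  by right; rewrite -VS; split => //; exact: UV.
by rewrite nuS finite_energy_atomless// adde0 => h; apply/eqP; rewrite -measure_le0.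
Qed.

End support.

(** * The equilibrium measure *)
Section equilibrium.
Variables (R : realType) (E : set (C R)) (rho : probability (borelC R) R).
Hypothesis Ecircle : E `<=` circle R.
Hypothesis Eclosed : closed E.

Lemma null_circle (nu : {measure set (borelC R) -> \bar R}) :
  nu (~` E) = 0%E -> nu (~` circle R) = 0%E.
Proof.
move=> nuE; apply: (subset_measure0 _ _ _ nuE).
- by apply: measurableC; apply: measurable_closed; exact: closed_circle.
- by apply: measurableC; exact: measurable_closed.
- by apply: subsetC.
Qed.

Lemma equilibrium_energy : (0 < capacity E)%E -> equilibrium_measure E rho ->
  exists V, [/\ min_energy E = V%:E, (\int[rho]_z pot rho z = (ln 2 + V)%:E)%E &
    forall nu : probability (borelC R) R, nu (~` E) = 0%E ->
      ((ln 2 + V)%:E <= \int[nu]_z pot nu z)%E].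
Proof.
move=> cap [rhoE rhomin].
have eE := energyE (null_circle rhoE); rewrite rhomin in eE.
have I0 : (0 <= \int[rho]_z pot rho z)%E by apply: integral_ge0 => z _; exact: pot_ge0.
have [I IE] : exists I, (\int[rho]_z pot rho z)%E = I%:E.
  move: cap eE I0; rewrite /capacity; case: (\int[rho]_z pot rho z)%E => [I _ _ _|cap eE _|//].
    by exists I.
  by move: cap; rewrite eE /= ltxx.
rewrite IE in eE; exists (I - ln 2); split.
- by rewrite eE.
- by rewrite IE [ln 2 + _]addrC subrK.
- move=> nu nuE; rewrite [ln 2 + _]addrC subrK.
  have : (min_energy E <= energy nu)%E by apply: ereal_inf_lbound; exists nu.
  by rewrite eE energyE ?null_circle// -EFinB leeBrDr// -EFinD subrK.
Qed.

End equilibrium.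

(** * Upper bound for the norms of orthogonal polynomials *)
Section upper_bound.
Variables (R : realType) (mu : {finite_measure set (borelC R) -> \bar R}) (V : R).
Hypothesis muC : mu (~` circle R) = 0%E.
Hypothesis closedE : closed (ess_spectrum mu).
Hypothesis E_neq0 : ess_spectrum mu !=set0.
Hypothesis minV : forall nu : probability (borelC R) R,
  nu (~` ess_spectrum mu) = 0%E -> ((ln 2 + V)%:E <= \int[nu]_z pot nu z)%E.

(** Otherwise greedy points in the support would lead to a measure on the support
    with energy at most [v], which by [finite_energy_ess_spectrum] lives on the
    essential spectrum, where the minimal energy is [V]. *)
Lemma small_monic v : v < V -> exists m (p : {poly C R}), [/\ (0 < m)%N, p \is monic,
  size p = m.+1 & forall z, supp mu z -> cabs p.[z] <= expR (- (m%:R * v))].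
Proof.
move=> vV; apply: contrapT => H.
have [nu [nuK nuI]] : exists nu : probability (borelC R) R,
    nu (~` supp mu) = 0%E /\ (\int[nu]_x pot nu x <= (ln 2 + v)%:E)%E.
  apply: leja_limit_measure; [exact: closed_supp|exact: supp_circle|].
  move=> p [|m] pm sp.
    have [z [zS _]] := E_neq0; exists z => //.
    have -> : p = 1.
      have := size1_polyC (eq_leq sp); move: pm => /monicP; rewrite lead_coefE sp /= => ->.
      by [].
    by rewrite mul0r oppr0 expR0 hornerC cabs1.
  apply: contrapT => h; apply: H; exists m.+1, p; split => // z zS.
  by apply: ltW; rewrite ltNge; apply/negP => h'; apply: h; exists z.
have nuE : nu (~` ess_spectrum mu) = 0%E.
  by apply: finite_energy_ess_spectrum => //; apply: le_lt_trans nuI _; rewrite ltry.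
have := le_trans (minV nuE) nuI; rewrite lee_fin; lra.
Qed.

(** With [n = q m + r], the polynomial [p ^+ q * 'X ^+ r] competes with [Phi n]; the
    bounded remainder [r] only costs a constant factor. *)
Lemma L2sq_upper (Phi : nat -> {poly C R}) v : (forall n, monic_OP mu n (Phi n)) ->
  v < V -> exists2 c, 0 < c & forall n, L2sq mu (Phi n) <= c * expR (- (2 * n%:R * v)).
Proof.
move=> OP vV; have [m [p [m0 pm sp pS]]] := small_monic vV.
pose M := fine (mu setT).
have M0 : 0 <= M by exact: fine_ge0.
have muT : mu setT = M%:E by rewrite /M fineK// fin_num_measure.
exists ((M + 1) * expR (2 * m%:R * `|v|)).
  by rewrite mulr_gt0 ?expR_gt0//; lra.
move=> n; pose q := (n %/ m)%N; pose r := (n %% m)%N.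
have nE : n = (q * m + r)%N by exact: divn_eq.
pose Q := p ^+ q * 'X ^+ r.
have pqm : p ^+ q \is monic by exact: monic_exp.
have Qm : Q \is monic by rewrite /Q monicMl//; exact: monicXn.
have sQ : size Q = n.+1.
  have X0 : 'X^r != 0 :> {poly C R} by rewrite -size_poly_eq0 size_polyXn.
  have := size_exp p q; rewrite sp /= => h.
  have s0 : (0 < size (p ^+ q))%N by rewrite lt0n size_poly_eq0 monic_neq0.
  by rewrite size_monicM// size_polyXn addnS /= -(prednK s0) h addSn nE mulnC.
apply: le_trans (monic_OP_minimal muC (OP n) Qm sQ) _.
have Qb z : supp mu z -> cabs Q.[z] ^+ 2 <= expR (- (2 * (q * m)%:R * v)).
  move=> zS; rewrite /Q hornerM horner_exp hornerXn cabsM !cabsX (supp_circle muC zS) expr1n mulr1.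
  rewrite -exprM.
  apply: (le_trans (lerXn2r _ _ _ (pS _ zS))); rewrite ?nnegrE ?cabs_ge0 ?expR_ge0//.
  by rewrite -expRM_natl ler_expR !natrM; rewrite le_eqVlt; apply/orP; left; apply/eqP; ring.
have Qi : L2sq mu Q <= M * expR (- (2 * (q * m)%:R * v)).
  rewrite -lee_fin -(L2sqE muC).
  apply: (@le_trans _ _ (\int[mu]_z (cst (expR (- (2 * (q * m)%:R * v)))%:E z))%E).
    apply: ae_ge0_le_integral => //.
    - by move=> z _; rewrite lee_fin sqr_ge0.
    - by apply/measurable_EFinP; case: (bdd_on_circle_cabs2 Q).
    - by move=> z _; rewrite lee_fin expR_ge0.
    exists (~` supp mu); split.
    - by apply: measurableC; apply: measurable_closed; exact: closed_supp.
    - exact: measure_supp.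
    - by move=> z h hz; apply: h => _; rewrite lee_fin Qb.
  by rewrite integral_cst// [X in (_ * X <= _)%E]muT -EFinM mulrC.
apply: (le_trans Qi); rewrite -[leRHS]mulrA -expRD.
apply: ler_pM => //; rewrite ?expR_ge0//; first lra.
rewrite ler_expR.
have -> : n%:R = (q * m)%:R + r%:R :> R by rewrite -natrD -nE.
have rm : r%:R <= m%:R :> R by rewrite ler_nat ltnW// ltn_mod.
have h1 : r%:R * v <= m%:R * `|v|.
  apply: (@le_trans _ _ (r%:R * `|v|)); first by rewrite ler_wpM2l// ler_norm.
  by rewrite ler_wpM2r.
lra.
Qed.

End upper_bound.

(** * Lower bound for the norms of orthogonal polynomials *)
Section dominated_from_below.
Variables (R : realType) (rho : probability (borelC R) R) (V : R).
Hypothesis rhoC : rho (~` circle R) = 0%E.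
Hypothesis potV : {ae rho, forall z, (pot rho z <= (ln 2 + V)%:E)%E}.
Variables (mu : {finite_measure set (borelC R) -> \bar R}) (f : borelC R -> R).
Hypothesis muC : mu (~` circle R) = 0%E.
Hypothesis mf : measurable_fun setT f.
Hypothesis mu_ge : forall A : set (borelC R), measurable A ->
  (\int[rho]_(x in A) (f x)%:E <= mu A)%E.
Hypothesis f_gt0 : {ae rho, forall x, 0 < f x}.

(** The sets where [f] is at least [1 / k.+1] exhaust almost all of the space. *)
Lemma large_domination eta : 0 < eta -> exists A de a,
  [/\ measurable A, 0 < de, rho A = a%:E, 1 - eta < a <= 1 &
  forall B, measurable B -> B `<=` A -> (de%:E * rho B <= mu B)%E].
Proof.
move=> eta0; pose A (k : nat) : set (borelC R) := [set z | k.+1%:R^-1 <= f z].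
have mA k : measurable (A k).
  have := emeasurable_fun_c_infty measurableT ((measurable_EFinP setT f).2 mf) (k.+1%:R^-1)%:E.
  by rewrite setTI.
have A_homo : {homo A : n m / (n <= m)%N >-> (n <= m)%O}.
  move=> n m nm; apply/subsetPset => z; rewrite /A /=; apply: le_trans.
  by rewrite lef_pV2 ?posrE// ler_nat.
have UA : rho (\bigcup_k A k) = 1%E.
  have mU : measurable (\bigcup_k A k) by exact: bigcupT_measurable.
  have : rho (~` \bigcup_k A k) = 0%E.
    apply: measure_negligible; first exact: measurableC.
    case: f_gt0 => N [mN N0 hN]; exists N; split => //.
    move=> z nz; apply: hN => /= fz; apply: nz.
    exists (Num.truncn (f z)^-1) => //; rewrite /A /=.
    by rewrite -[leRHS]invrK lef_pV2 ?posrE ?invr_gt0// ltW// truncnS_gt.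
  rewrite probability_setC// => h.
  have : (rho (\bigcup_k A k) \is a fin_num) by exact: fin_num_measure.
  by move: h; case: (rho _) => [r||]//; rewrite -EFinB => -[] h _; congr EFin; lra.
have cA : (fun k => rho (A k)) @ \oo --> 1%E.
  by rewrite -UA; apply: nondecreasing_cvg_mu => //; exact: bigcupT_measurable.
have [k kA] : exists k, ((1 - eta)%:E < rho (A k))%E.
  apply: contrapT => /forallNP H.
  have : (limn_einf (fun k => rho (A k)) <= (1 - eta)%:E)%E.
    by apply: limn_einf_le => k; rewrite leNgt; apply/negP; exact: H.
  by rewrite (cvg_limn_einf_sup cA).1 lee_fin; lra.
exists (A k), k.+1%:R^-1, (fine (rho (A k))).
have rAfin : rho (A k) \is a fin_num by exact: fin_num_measure.
split=> //.
- by rewrite fineK.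
- by rewrite -lte_fin -!lee_fin fineK// kA probability_le1.
- move=> B mB BA; apply: le_trans (mu_ge mB).
  rewrite -integral_cst//; apply: ge0_le_integral => //.
  - by move=> z _; rewrite lee_fin invr_ge0.
  - by apply/measurable_EFinP; exact: measurable_funTS.
Qed.

Let V0 : 0 <= ln 2 + V.
Proof.
have [z] := ae_witness potV; rewrite -lee_fin; apply: le_trans; exact: pot_ge0.
Qed.

Lemma monic_L2sq_gt0 (p : {poly C R}) n : p \is monic -> size p = n.+1 -> 0 < L2sq mu p.
Proof.
move=> pm sp; rewrite lt_def L2sq_ge0 andbT; apply/eqP => p0.
have [A [de [a [mA de0 rA /andP[a0 a1] hA]]]] := @large_domination 2^-1 ltac:(lra).
have [B _ hB] := poly_bounded p.
have B1 : 1 <= Num.max 1 B by rewrite le_max lexx.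
pose k := 2 * n%:R * ln 2 - 2 * n%:R * (ln 2 + V) - 2 * (1 - a) * ln (Num.max 1 B).
(* With norm zero the tangent point is free; this one reduces the bound to
   [k <= k - a]. *)
have := @monic_L2_lower_bound _ _ _ rhoC potV mu A de a (Num.max 1 B) (expR (k / a)) 0 p n
  mA de0 hA rA B1 (expR_gt0 _) pm sp.
rewrite mul0r add0r expRK => h.
have {h} : 2 * n%:R * ln 2 - 2 * n%:R * (ln 2 + V) <=
    a * (k / a - 1) + 2 * (1 - a) * ln (Num.max 1 B).
  apply: h; last by rewrite (L2sqE muC) p0.
  by move=> w cw; rewrite le_max hB ?orbT.
have ap : 0 < a by lra.
have -> : a * (k / a - 1) = k - a by rewrite mulrBr mulr1 mulrCA divff ?mulr1// gt_eqF.
by rewrite /k; lra.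
Qed.

Lemma L2sq_lower v : V < v -> exists2 c, 0 < c & forall (p : {poly C R}) n,
  p \is monic -> size p = n.+1 -> (forall w, circle R w -> cabs p.[w] <= 2 ^+ n) ->
  c * expR (- (2 * n%:R * v)) <= L2sq mu p.
Proof.
(* The set left out by [large_domination] may cost [eta * (ln 2 + v)] in the rate,
   which has to stay below [v - V]. *)
move=> Vv; pose eta := (v - V) / (2 * (ln 2 + v)).
have v0 : 0 < ln 2 + v by move: V0; lra.
have eta0 : 0 < eta by rewrite divr_gt0 ?subr_gt0 ?mulr_gt0.
have etaE : eta * (2 * (ln 2 + v)) = v - V by rewrite /eta divfK// gt_eqF// mulr_gt0.
have eta1 : eta <= 2^-1.
  by rewrite /eta ler_pdivrMr ?mulr_gt0// mulrA mulVf// mul1r; move: V0; lra.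
have [A [de [a [mA de0 rA /andP[a0 a1] hA]]]] := large_domination eta0.
have ap : 0 < a by lra.
exists (de * a); first by rewrite mulr_gt0.
move=> p n pm sp pb; have p0 := monic_L2sq_gt0 pm sp; set X := L2sq mu p in p0 *.
have B1 : 1 <= 2 ^+ n :> R by rewrite exprn_ege1// ler1n.
(* The tangent point is the bound for the mean of [|p| ^ 2] over [A]. *)
pose c := X / (de * a).
have c0 : 0 < c by rewrite divr_gt0// mulr_gt0.
have := @monic_L2_lower_bound _ _ _ rhoC potV mu A de a (2 ^+ n) c X p n
  mA de0 hA rA B1 c0 pm sp pb.
rewrite (L2sqE muC) lexx => /(_ isT).
have -> : X / (de * c) = a by rewrite /c; field; rewrite !gt_eqF.
rewrite lnXn// -[ln 2 *+ n]mulr_natl => h.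
have h1 : - (2 * n%:R * v) <= ln c.
  have n0 : 0 <= n%:R :> R by [].
  have h2 : (1 - a) * (ln 2 + v) <= v - V.
    rewrite -etaE mulrCA; apply: (@le_trans _ _ (eta * (ln 2 + v))).
      by rewrite ler_wpM2r// ?ltW//; lra.
    have : 0 < eta * (ln 2 + v) by rewrite mulr_gt0.
    lra.
  have h3 : 2 * n%:R * ((1 - a) * (ln 2 + v)) <= 2 * n%:R * (v - V).
    by rewrite ler_wpM2l// mulr_ge0.
  rewrite -(ler_pM2l ap); lra.
by rewrite mulrC -ler_pdivlMr ?mulr_gt0// -/c -[leRHS](lnK c0) ler_expR.
Qed.

End dominated_from_below.

(** * Root asymptotics *)
Section root_asymptotics.
Variable R : realType.

(** Two exponential bounds, for every rate above and below the limit, fix the root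
    asymptotics; constant factors and a shift of the index are harmless. *)
Lemma root_limit (x : nat -> R) (V x1 : R) : 0 < x1 -> (forall n, 0 < x n) ->
  (forall v, v < V -> exists2 c, 0 < c & forall n, x n <= c * expR (- (2 * n%:R * v))) ->
  (forall v, V < v -> exists2 c, 0 < c & forall n, c * expR (- (2 * n%:R * v)) <= x n) ->
  (fun n : nat => Num.sqrt (x n.+1 / x1) `^ n%:R^-1) @ \oo --> expR (- V).
Proof.
move=> x10 x0 up low.
have lnx n : ln (Num.sqrt (x n.+1 / x1)) = 2^-1 * (ln (x n.+1) - ln x1).
  have q0 : 0 < x n.+1 / x1 by rewrite divr_gt0.
  have h : ln (x n.+1 / x1) = 2 * ln (Num.sqrt (x n.+1 / x1)).
    by rewrite -{1}(sqr_sqrtr (ltW q0)) lnXn ?sqrtr_gt0// mulr_natl.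
  by rewrite -ln_div ?posrE// h mulrA mulVf// mul1r.
pose L n := n%:R^-1 * (2^-1 * (ln (x n.+1) - ln x1)).
suff LV : L @ \oo --> - V.
  apply: (@cvg_trans _ ((fun n => expR (L n)) @ \oo)).
    apply: near_eq_cvg; near=> n.
    by rewrite /L -lnx /powR gt_eqF// sqrtr_gt0 divr_gt0.
  exact: (continuous_cvg _ (@continuous_expR R (- V))).
apply/cvgrPdist_le => e e0; have e20 : 0 < e / 2 by lra.
have [c1 c10 H1] := up (V - e / 2) ltac:(lra).
have [c2 c20 H2] := low (V + e / 2) ltac:(lra).
pose K1 := 2^-1 * (ln c1 - ln x1) - (V - e / 2).
pose K2 := 2^-1 * (ln c2 - ln x1) - (V + e / 2).
have B1 n : 2^-1 * (ln (x n.+1) - ln x1) <= K1 - n%:R * (V - e / 2).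
  have : ln (x n.+1) <= ln (c1 * expR (- (2 * n.+1%:R * (V - e / 2)))).
    by rewrite ler_ln ?posrE ?mulr_gt0 ?expR_gt0.
  rewrite lnM ?posrE ?expR_gt0// expRK -[n.+1%:R]natr1 /K1; lra.
have B2 n : K2 - n%:R * (V + e / 2) <= 2^-1 * (ln (x n.+1) - ln x1).
  have : ln (c2 * expR (- (2 * n.+1%:R * (V + e / 2)))) <= ln (x n.+1).
    by rewrite ler_ln ?posrE ?mulr_gt0 ?expR_gt0.
  rewrite lnM ?posrE ?expR_gt0// expRK -[n.+1%:R]natr1 /K2; lra.
near=> n.
have n0 : 0 < n%:R :> R by rewrite ltr0n; near: n; exact: nbhs_infty_gt.
have K1n : `|K1| <= n%:R * (e / 2).
  rewrite -ler_pdivrMr//; near: n; exact: nbhs_infty_ger.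
have K2n : `|K2| <= n%:R * (e / 2).
  rewrite -ler_pdivrMr//; near: n; exact: nbhs_infty_ger.
have nL : n%:R * L n = 2^-1 * (ln (x n.+1) - ln x1) by rewrite /L mulrA divff ?mul1r// gt_eqF.
have := B1 n; have := B2 n; rewrite -nL => b2 b1.
rewrite ler_norml -(ler_pM2l n0 (- e)) -(ler_pM2l n0 _ e).
move: K1n K2n; rewrite !ler_norml => /andP[k1 k2] /andP[k3 k4].
by apply/andP; split; lra.
Unshelve. all: by end_near.
Qed.

End root_asymptotics.

Section verblunsky_products.
Variables (R : realType) (mu : {finite_measure set (borelC R) -> \bar R}).
Variables (alpha : nat -> C R) (Phi : nat -> {poly C R}).
Hypothesis muC : mu (~` circle R) = 0%E.
Hypothesis OP : forall n, monic_OP mu n (Phi n).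
Hypothesis rec : forall n, Phi n.+1 = 'X * Phi n - (alpha n)^* *: revpoly n (Phi n).
Hypothesis Phi_gt0 : forall n, 0 < L2sq mu (Phi n).

Lemma verblunsky_ratio n : 1 - cabs (alpha n) ^+ 2 = L2sq mu (Phi n.+1) / L2sq mu (Phi n).
Proof.
rewrite (L2sq_verblunsky muC (OP n) (OP n.+1) (rec n)) -mulrA divff ?mulr1//.
by rewrite gt_eqF.
Qed.

Lemma cabs_verblunsky_le1 n : cabs (alpha n) <= 1.
Proof.
have : 0 < 1 - cabs (alpha n) ^+ 2 by rewrite verblunsky_ratio divr_gt0.
by rewrite subr_gt0 expr_lt1 ?cabs_ge0// => /ltW.
Qed.

(** One step of the recursion at most doubles the maximum on the circle. *)
Lemma cabs_OP_le n z : circle R z -> cabs (Phi n).[z] <= 2 ^+ n.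
Proof.
move=> cz; elim: n => [|n IH].
  have [pm sp _] := OP 0%N; have := size1_polyC (eq_leq sp).
  by move: pm => /monicP; rewrite lead_coefE sp /= => -> ->; rewrite hornerC cabs1 expr0.
have [_ sPhi _] := OP n.
rewrite rec hornerD hornerN hornerZ hornerM hornerX; apply: le_trans (ler_cabsD _ _) _.
rewrite cabsN !cabsM cz mul1r cabs_conj cabs_revpoly ?sPhi// exprS mulr_natl mulr2n lerD//.
by rewrite -[leRHS]mul1r ler_pM ?cabs_ge0// cabs_verblunsky_le1.
Qed.

Lemma prod_rho_coef n :
  \prod_(1 <= k < n.+1) rho_coef alpha k = Num.sqrt (L2sq mu (Phi n.+1) / L2sq mu (Phi 1%N)).
Proof.
elim: n => [|n IH]; first by rewrite big_geq// divff ?sqrtr1// gt_eqF.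
rewrite big_nat_recr//= IH /rho_coef verblunsky_ratio -sqrtrM; last by rewrite divr_ge0// ltW.
by congr Num.sqrt; field; rewrite !gt_eqF.
Qed.

End verblunsky_products.

Theorem theorem9p1 (R : realType) (E : set (C R))
    (mu : {finite_measure set (borelC R) -> \bar R})
    (rhoE : probability (borelC R) R) (f : borelC R -> R)
    (mu_s : {measure set (borelC R) -> \bar R}) (alpha : nat -> C R) :
  E `<=` circle R -> closed E ->
  (0 < capacity E)%E ->
  capacity (E `\` circle_interior E) = 0%E ->
  equilibrium_measure E rhoE ->
  mu (~` circle R) = 0%E ->
  ess_spectrum mu = E ->
  measurable_fun setT f ->
  (forall A : set (borelC R), measurable A ->
    mu A = (\int[rhoE]_(x in A) (f x)%:E + mu_s A)%E) ->
  mutually_singular rhoE mu_s ->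
  {ae rhoE, forall x, 0 < f x} ->
  verblunsky mu alpha ->
  (fun n : nat => ((\prod_(1 <= k < n.+1) rho_coef alpha k) `^ n%:R^-1)%:E)
    @ \oo --> capacity E.
Proof.
move=> Ecircle Eclosed capE _ eqE muC specE mf muE _ f_gt0 [Phi [OP rec]].
have rhoE0 : rhoE (~` E) = 0%E by case: eqE.
have rhoC := null_circle Ecircle Eclosed rhoE0.
have [V [VE rhoV minV]] := equilibrium_energy Ecircle Eclosed capE eqE.
have potV := potential_le_ae (measurable_closed Eclosed) rhoE0 rhoV minV.
have mu_ge (A : set (borelC R)) : measurable A -> (\int[rhoE]_(x in A) (f x)%:E <= mu A)%E.
  by move=> mA; rewrite muE// leeDl.
have X0 n : 0 < L2sq mu (Phi n).
  have [pm sp _] := OP n; exact: (monic_L2sq_gt0 rhoC potV muC mf mu_ge f_gt0 pm sp).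
have E_neq0 : ess_spectrum mu !=set0.
  rewrite specE; apply/set0P/eqP => E0; move: rhoE0.
  by rewrite E0 setC0 => /eqP; rewrite probability_setT onee_eq0.
rewrite /capacity VE /=; apply: cvg_EFin; first exact: nearW.
rewrite [X in X @ _](_ : _ = fun n : nat =>
   Num.sqrt (L2sq mu (Phi n.+1) / L2sq mu (Phi 1%N)) `^ n%:R^-1); last first.
  by apply/funext => n /=; rewrite (prod_rho_coef muC OP rec X0).
apply: (@root_limit R (fun n => L2sq mu (Phi n)) V _ (X0 1%N) X0).
- move=> v vV; apply: (@L2sq_upper _ mu V) => //; rewrite specE//.
- move=> v Vv; have [c c0 H] := L2sq_lower rhoC potV muC mf mu_ge f_gt0 Vv.
  exists c => // n; have [pm sp _] := OP n; apply: H => // w cw.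
  exact: (cabs_OP_le muC OP rec X0).
Qed.
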